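(* Let $n\ge 1$. An algebraic subset of $\mathbb R^n$ is of type A if and only if it is of type C.
   Context: $\mathbb C[X_1,\ldots,X_n]$ is regarded as a $*$-algebra with involution $(R+\mathrm iS)^*=R-\mathrm iS$ for $R,S\in\mathbb R[X_1,\ldots,X_n]$ (so $X_j^*=X_j$). For $P\in\mathbb C[X_1,\ldots,X_n]$, let $\mathcal Z_P=\{x\in\mathbb R^n: P(x)=0\}$ and let $(P)_{\mathsf c}$ be the ideal of $\mathbb C[X_1,\ldots,X_n]$ generated by $P$. Algebraic subsets of $\mathbb R^n$ are exactly the sets $\mathcal Z_P$; $V=\mathcal Z_P$ is said to be induced by $P$. For $Z\subset\mathbb R^n$, let $\mathcal I_{\mathsf c}(Z)=\{R\in\mathbb C[X_1,\ldots,X_n]: R(x)=0\text{ for every }x\in Z\}$. A complex linear functional $\Lambda:\mathbb C[X_1,\ldots,X_n]\to\mathbb C$ is positive definite if $\Lambda(R^*R)\ge0$ for all $R$; for such $\Lambda$ put $\mathcal I^{\mathsf c}_\Lambda=\{R\in\mathbb C[X_1,\ldots,X_n]:\Lambda(R^*R)=0\}$. $\Lambda$ is a moment functional if there is a positive Borel measure $\mu$ on $\mathbb R^n$, with respect to which all polynomials are absolutely integrable, such that $\Lambda(R)=\int_{\mathbb R^n}R\,d\mu$ for all $R\in\mathbb C[X_1,\ldots,X_n]$. A polynomial $P\in\mathbb C[X_1,\ldots,X_n]$ is of type A if every positive definite complex linear functional on $\mathbb C[X_1,\ldots,X_n]$ vanishing on $(P)_{\mathsf c}$ is a moment functional; an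 algebraic set $V=\mathcal Z_P$ is of type A if $P$ is of type A (this does not depend on the choice of the polynomial $P$ inducing $V$). A $*$-ideal $I$ of $\mathbb C[X_1,\ldots,X_n]$ (an ideal closed under the involution) is of type C if every positive definite complex linear functional $\Lambda$ on $\mathbb C[X_1,\ldots,X_n]$ satisfying $\mathcal I^{\mathsf c}_\Lambda=I$ is a moment functional. An algebraic subset $V$ of $\mathbb R^n$ is of type C if the ideal $\mathcal I_{\mathsf c}(V)$ is of type C. *)

(* Defs.v *)
From HB Require Import structures.
From mathcomp Require Import all_boot all_order all_algebra.
From mathcomp Require Import all_classical all_reals all_analysis.
From mathcomp.real_closed Require Export complex.
From mathcomp Require mpoly.
(* The notations of mpoly clash with those of mathcomp-analysis; in particular
   {mpoly R[i][n]} has to be written mpoly n R[i]. *)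
Export -(notations) mpoly.
Set Implicit Arguments.
Unset Strict Implicit.
Unset Printing Implicit Defensive.
Import Order.TTheory GRing.Theory Num.Theory numFieldNormedType.Exports.
Local Open Scope classical_set_scope.
Local Open Scope ring_scope.
Local Open Scope complex_scope.

Section Definitions.
Context {R : realType} {n : nat}.
Implicit Types (P Q : mpoly n R[i]) (V Z : set 'rV[R]_n).
Implicit Types (L : {scalar mpoly n R[i]}).

(* (R + iS)^* = R - iS: the involution conjugates the coefficients. *)
Definition star P : mpoly n R[i] := map_mpoly (@conjc R) P.

Definition peval P (x : 'rV[R]_n) : R[i] := meval (fun i => (x 0 i)%:C) P.

Definition zero_locus P : set 'rV[R]_n := [set x | peval P x = 0].

Definition algebraic_set V := exists P, V = zero_locus P.

Definition principal_ideal P : set (mpoly n R[i]) :=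
  [set Q | exists S, Q = S * P].

Definition vanishing_set Z : set (mpoly n R[i]) :=
  [set P | forall x, Z x -> peval P x = 0].

(* MathComp's ideal predicates require properness, but the ideal of the empty
   set is the whole ring. *)
Record star_ideal := StarIdeal {
  star_ideal_set :> set (mpoly n R[i]);
  star_ideal0 : star_ideal_set 0;
  star_idealD : forall P Q,
    star_ideal_set P -> star_ideal_set Q -> star_ideal_set (P + Q);
  star_idealM : forall P Q, star_ideal_set Q -> star_ideal_set (P * Q);
  star_ideal_star : forall P, star_ideal_set P -> star_ideal_set (star P) }.

Lemma peval_star P x : peval (star P) x = (peval P x)^*.
Proof.
elim/mpolyind: P => [|c m P _ _ IH]; first by rewrite /star raddf0 /peval meval0 conjc0.
rewrite /star raddfD /= /peval !mevalD rmorphD /= -/(peval P x) -IH; congr (_ + _).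
rewrite map_mpolyZ map_mpolyX !mevalZ rmorphM /=; congr (_ * _).
rewrite !mevalX rmorph_prod; apply: eq_bigr => i _.
by rewrite rmorphXn /= oppr0.
Qed.

Definition vanishing_ideal Z : star_ideal.
Proof.
apply: (@StarIdeal (vanishing_set Z)).
- by move=> x _; rewrite /peval meval0.
- by move=> P Q P0 Q0 x Zx; rewrite /peval mevalD [X in X + _]P0 // [X in _ + X]Q0 // addr0.
- by move=> P Q Q0 x Zx; rewrite /peval mevalM [X in _ * X]Q0 // mulr0.
- by move=> P P0 x Zx; rewrite peval_star P0 // conjc0.
Defined.

(* In R[i], 0 <= z means that z is real and nonnegative. *)
Definition positive_definite L := forall P, 0 <= L (star P * P).

Definition null_set L : set (mpoly n R[i]) := [set P | L (star P * P) = 0].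

Definition borelRn := g_sigma_algebraType (@open 'rV[R]_n).

(* The first clause is the absolute integrability of all polynomials (they are
   continuous, hence Borel measurable); it makes both real integrals finite. *)
Definition moment_functional L :=
  exists mu : {measure set borelRn -> \bar R},
    (forall P, (\int[mu]_x (Normc.normc (peval P x))%:E < +oo)%E) /\
    (forall P, L P =
       Rintegral mu setT (fun x : borelRn => complex.Re (peval P x)) +i*
       Rintegral mu setT (fun x : borelRn => complex.Im (peval P x))).

Definition type_A P := forall L, positive_definite L ->
  (forall Q, principal_ideal P Q -> L Q = 0) -> moment_functional L.

(* Whether P is of type A depends only on zero_locus P. *)
Definition type_A_set V := exists P, V = zero_locus P /\ type_A P.

Definition type_C (I : star_ideal) := forall L, positive_definite L ->
  null_set L = I -> moment_functional L.

Definition type_C_set V := type_C (vanishing_ideal V).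

End Definitions.

(* Main.v *)
(** The direction from type A to type C is the Cauchy-Schwarz inequality: if
    [L (P^* P) = 0] then [L] vanishes on the ideal generated by [P].

    Conversely, let [V] be of type C.  By Hilbert's basis theorem the vanishing
    ideal of [V] has finitely many generators [Q_i]; then [P = \sum Q_i^* Q_i]
    induces [V], and a positive definite [L] vanishing on [(P)] vanishes on the
    vanishing ideal of [V].  Let [L0] be the functional of a summable atomic measure
    whose atoms are dense in [V]; the null set of [L + L0 / (k + 1)] is exactly the
    vanishing ideal of [V], so each of these is a moment functional.  Finally, a
    pointwise limit of moment functionals is a moment functional: bounds on the
    second moments prevent the escape of mass to infinity, and the limit measure is
    obtained as the law of a random variable on an interval with Lebesgue measure. *)
From HB Require Import structures.
Require Import Defs.
From mathcomp Require Import all_boot all_order all_algebra.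
From mathcomp Require Import all_classical all_reals all_analysis.
From mathcomp Require Import measurable_realfun ring lra.
Set Implicit Arguments.
Unset Strict Implicit.
Unset Printing Implicit Defensive.
Import Order.TTheory GRing.Theory Num.Theory numFieldNormedType.Exports.
Local Open Scope classical_set_scope.
Local Open Scope ring_scope.
Local Open Scope complex_scope.

(** * Hilbert's basis theorem *)

(** From every rank on, [f] attains a least value; [phi] jumps each time to an index where the least
    value beyond the previous index is attained. *)
Lemma nondecreasing_subsequence (f : nat -> nat) :
  exists phi : nat -> nat, {homo phi : i j / (i < j)%N} /\
    {homo f \o phi : i j / (i <= j)%N}.
Proof.
have /choice[g gP] : forall N, exists i, (N <= i)%N /\
    forall j, (N <= j)%N -> (f i <= f j)%N.
  move=> N.
  have ex : exists v, `[< exists2 i, (N <= i)%N & f i = v >].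
    by exists (f N); apply/asboolP; exists N.
  case: (ex_minnP ex) => v /asboolP[i Ni <-] vmin.
  by exists i; split=> // j Nj; apply: vmin; apply/asboolP; exists j.
pose phi := fix phi k := if k is k'.+1 then g (phi k').+1 else g 0%N.
exists phi; split.
  apply: homo_ltn => [? ? ? |i]; first exact: ltn_trans.
  by case: (gP (phi i).+1).
apply: homo_leq => [//|? ? ? |i]; first exact: leq_trans.
case: i => [|i] /=.
  by apply: (gP 0%N).2.
apply: (gP (phi i).+1).2.
have h := (gP (phi i).+1).1.
by apply: (leq_trans h); apply: (leq_trans (leqnSn _)); exact: (gP _).1.
Qed.

(** Subsequences are extracted for one coordinate after another until all exponents are
    nondecreasing along [phi]; its first two terms are then comparable. *)
Lemma dickson n (m : nat -> multinom n) :
  exists i j, (i < j)%N /\ mpoly.lem (m i) (m j).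
Proof.
have [phi [phi_lt phi_le]] : exists phi : nat -> nat,
    {homo phi : i j / (i < j)%N} /\
    forall l, l \in enum 'I_n -> {homo (fun k => m (phi k) l) : i j / (i <= j)%N}.
  elim: (enum 'I_n) => [|l s [phi [phi_lt phi_le]]]; first by exists id; split.
  have [psi [psi_lt psi_le]] := nondecreasing_subsequence (fun k => m (phi k) l).
  exists (phi \o psi); split=> [i j ij /=|l']; first exact/phi_lt/psi_lt.
  rewrite inE => /orP[/eqP ->//|l's] i j ij /=.
  apply: phi_le => //; move: ij; rewrite leq_eqVlt => /orP[/eqP->//|/psi_lt].
  exact: ltnW.
exists (phi 0%N), (phi 1%N); split; first exact: phi_lt.
by apply/mnm_lepP => l; apply: phi_le => //; rewrite mem_enum.
Qed.

Local Notation lc p := (mcoeff (mlead p) p).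

Definition is_ideal (A : pzRingType) (J : set A) :=
  [/\ J 0, forall P Q, J P -> J Q -> J (P + Q) & forall P Q, J Q -> J (P * Q)].

(** If no finite [s] generates [I], elements of [I] outside the ideal generated so far can be
    adjoined forever, each with least possible leading monomial. By Dickson's lemma an earlier
    leading monomial divides a later one, and cancelling the later leading term contradicts
    minimality. *)
Theorem hilbert_basis (K : fieldType) n (I : set (mpoly n K)) : is_ideal I ->
  exists s : seq (mpoly n K), (forall P, P \in s -> I P) /\
    forall J, is_ideal J -> (forall P, P \in s -> J P) -> I `<=` J.
Proof.
move=> [I0 ID IM]; apply: contrapT => notfg.
pose gen (s : seq (mpoly n K)) : set (mpoly n K) :=
  [set Q | forall J, is_ideal J -> (forall P, P \in s -> J P) -> J Q].
have gen_ideal s : is_ideal (gen s).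
  split; first by move=> J [].
  - by move=> P Q gP gQ J iJ sJ; have [_ JD _] := iJ; apply: JD; [exact: gP|exact: gQ].
  - by move=> P Q gQ J iJ sJ; have [_ _ JM] := iJ; apply: JM; exact: gQ.
have /choice[next nextP] : forall s : seq (mpoly n K), exists P,
    (forall Q, Q \in s -> I Q) -> [/\ I P, ~ gen s P &
      forall Q, I Q -> ~ gen s Q -> (mlead P <= mlead Q)%O].
  move=> s; have [sI|] := pselect (forall Q, Q \in s -> I Q); last by exists 0.
  have [P IP nP] : exists2 P, I P & ~ gen s P.
    apply: contrapT => /forall2NP h; apply: notfg; exists s; split=> // J iJ sJ P IP.
    by have [//|/contrapT] := h P; exact.
  move: {2}(mlead P) (erefl (mlead P)) => m.
  elim/(well_founded_ind (@ltom_wf n)): m P IP nP => m IH P IP nP Pm.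
  have [[Q [IQ nQ QP]]|h] := pselect (exists Q, [/\ I Q, ~ gen s Q & (mlead Q < mlead P)%O]).
    by apply: (IH _ _ Q) => //; rewrite -Pm.
  exists P => _; split=> // Q IQ nQ; rewrite leNgt; apply/negP => QP.
  by apply: h; exists Q.
pose S := fix S k := if k is k'.+1 then next (S k') :: S k' else [::].
have SI k Q : Q \in S k -> I Q.
  elim: k Q => [//|k IH] Q /=; rewrite inE => /orP[/eqP->|/IH//].
  by have [] := nextP _ IH.
have Smem i j : (i < j)%N -> next (S i) \in S j.
  elim: j => [//|j IH]; rewrite ltnS leq_eqVlt /= inE => /orP[/eqP->|/IH ->].
    by rewrite eqxx.
  by rewrite orbT.
have [i [j [ij mij]]] := dickson (fun k => mlead (next (S k))).
have [Ii ni _] := nextP _ (SI i); have [Ij nj minj] := nextP _ (SI j).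
move: (Smem _ _ ij) Ii ni Ij nj minj mij.
set p := next (S i); set q := next (S j) => pS Ip np Iq nq minq pq.
have [G0 GD GM] := gen_ideal (S j).
have p0 : p != 0 by apply: contra_notN np => /eqP->; have [] := gen_ideal (S i).
have q0 : q != 0 by apply: contra_notN nq => /eqP->.
pose T : mpoly n K := (lc q / lc p) *: mpolyX K (mnm_sub (mlead q) (mlead p)).
have gp : gen (S j) p by move=> J iJ; exact.
have mT : mcoeff (mlead q) (T * p) = lc q.
  rewrite /T -scalerAl mcoeffZ mulrC.
  have := mcoeffMX p (mnm_sub (mlead q) (mlead p)) (mlead p).
  rewrite submK // -commr_mpolyX => ->.
  by rewrite mulrC divfK // mleadc_eq0.
have nQ : ~ gen (S j) (q - T * p).
  by move=> h; apply: nq; rewrite -(subrK (T * p) q); apply: GD => //; apply: GM.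
have IQ : I (q - T * p) by apply: ID => //; rewrite -mulNr; apply: IM.
have := minq _ IQ nQ.
have c0 : mcoeff (mlead q) (q - T * p) = 0 by rewrite mcoeffB mT subrr.
have T0 : T * p != 0.
  apply: contra_neq q0 => h; apply/eqP; rewrite -mleadc_eq0 -mT h mcoeff0 //.
have le : (mlead (q - T * p) <= mlead q)%O.
  apply: le_trans (mleadB_le _ _) _; rewrite leUx lexx /=.
  have cq : lc q / lc p != 0 by rewrite mulf_neq0 ?invr_eq0 ?mleadc_eq0.
  rewrite /T -scalerAl mleadZ //.
  apply: le_trans (mleadM_le _ _) _; rewrite mleadXm submK //.
(* The coefficient of [q - T * p] at [mlead q] is 0; if this is also its leading monomial, the
   difference is 0 and lies in every ideal. *)
move=> ge; have /eqP e : mlead (q - T * p) == mlead q by rewrite eq_le le ge.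
by move: c0; rewrite -e => /eqP; rewrite mleadc_eq0 => /eqP h; apply: nQ; rewrite h.
Qed.

(** * Skorokhod representation of limits of finite measures *)

(** Compactness gives a cluster point along [U], and an ultrafilter converges to each of its cluster
    points. Limits thus exist for the masses of all cells at once, without extracting
    subsequences. *)
Lemma ultra_bounded_cvg (R : realType) I (U : set_system I) (UU : UltraFilter U)
  (a b : R) (f : I -> R) : (forall i, a <= f i <= b) ->
  exists2 p, a <= p <= b & f i @[i --> U] --> p.
Proof.
move=> fab.
have [|p [pab clp]] := @segment_compact R a b (f @ U) _.
  have : U (f @^-1` `[a, b]) by apply: filterE => i; rewrite /= in_itv /= fab.
  exact.
exists p; first by move: pab; rewrite /= in_itv.
move=> B pB; have [//|UB] := in_ultra_setVsetC (f @^-1` B) UU.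
by have [x [nBx /nBx]] := clp (~` B) B UB pB.
Qed.

Section words.
Context {T : Type} (A : nat -> set T).

(* The first [D] answers to the questions [x \in A 0], [x \in A 1], ..., most
   recent answer first. *)
Fixpoint word D x : seq bool :=
  if D is D'.+1 then `[< A D' x >] :: word D' x else [::].

Definition cell s : set T := [set x | word (size s) x = s].

Lemma size_word D x : size (word D x) = D.
Proof. by elim: D => //= D ->. Qed.

Lemma word_le D E x y : (D <= E)%N -> word E x = word E y -> word D x = word D y.
Proof.
elim: E => [|E IH]; first by rewrite leqn0 => /eqP->.
by rewrite leq_eqVlt ltnS => /orP[/eqP->//|DE /= [_]]; exact: IH.
Qed.

Lemma word_in D E x y : (D < E)%N -> word E x = word E y -> A D x <-> A D y.
Proof.
move=> DE /(word_le DE) /= [Axy _].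
by split=> /asboolP; [rewrite Axy|rewrite -Axy] => /asboolP.
Qed.

Lemma cell_cons b s :
  cell (b :: s) = cell s `&` (if b then A (size s) else ~` A (size s)).
Proof.
apply/seteqP; split=> x; rewrite /cell /=.
  by move=> [<- ->]; split=> //; case: asboolP.
move=> [-> bx]; congr cons.
by case: b bx => bx; [exact/asboolP|exact/negbTE/asboolPn].
Qed.

Lemma cell_split s : cell s = cell (false :: s) `|` cell (true :: s).
Proof. by rewrite !cell_cons -setIUr setUC setUv setIT. Qed.

Lemma cell_disj s : cell (false :: s) `&` cell (true :: s) = set0.
Proof. by rewrite !cell_cons setIACA setIid setICl setI0. Qed.

End words.

Lemma measurable_cell d (T : measurableType d) (A : nat -> set T) s :
  (forall D, measurable (A D)) -> measurable (cell A s).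
Proof.
move=> mA; elim: s => [|b s IH].
  by rewrite (_ : cell _ _ = setT) //; apply/seteqP; split.
by rewrite cell_cons; apply: measurableI => //; case: b => //; exact: measurableC.
Qed.

Section skorokhod.
Context (R : realType) (d : measure_display) (T : measurableType d) (x0 : T).
Context (mu : nat -> {measure set T -> \bar R}) (C : R).
Hypothesis mu_le : forall k, (mu k setT <= C%:E)%E.
Context (A : nat -> set T).
Hypothesis mA : forall D, measurable (A D).
Context (U : set_system nat) (UU : UltraFilter U).

Let mu_cell s k := fine (mu k (cell A s)).

Let mu_fin k B : measurable B -> mu k B \is a fin_num.
Proof.
move=> mB; rewrite ge0_fin_numE //; apply: le_lt_trans (ltry C).
by apply: le_trans (mu_le k); apply: le_measure; rewrite ?inE.
Qed.

Let mu_cell_cvg s : exists2 p, 0 <= p <= C & mu_cell s k @[k --> U] --> p.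
Proof.
apply: ultra_bounded_cvg => k; rewrite fine_ge0 //= -lee_fin fineK.
  by apply: le_trans (mu_le k); apply: le_measure; rewrite ?inE //; exact: measurable_cell.
by apply: mu_fin; exact: measurable_cell.
Qed.

Let m s := lim (mu_cell s k @[k --> U]).

Let m_cvg s : mu_cell s k @[k --> U] --> m s.
Proof. by have [p _ h] := mu_cell_cvg s; rewrite /m (cvg_lim _ h). Qed.

Let m_ge0 s : 0 <= m s.
Proof. by have [p /andP[p0 _] h] := mu_cell_cvg s; rewrite /m (cvg_lim _ h). Qed.

Let m_split s : m s = m (false :: s) + m (true :: s).
Proof.
suff : mu_cell s k @[k --> U] --> m (false :: s) + m (true :: s).
  by move/cvg_lim; exact.
have -> : mu_cell s = mu_cell (false :: s) \+ mu_cell (true :: s).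
  apply/funext => k; rewrite /mu_cell /= [in LHS]cell_split measureU.
  - by rewrite fineD // mu_fin //; exact: measurable_cell.
  - exact: measurable_cell.
  - exact: measurable_cell.
  - exact: cell_disj.
by apply: cvgD; exact: m_cvg.
Qed.

Let m_cell0 s : cell A s = set0 -> m s = 0.
Proof.
move=> s0; rewrite /m /mu_cell s0.
under eq_fun do rewrite measure0 /=.
exact: lim_cst.
Qed.

(* The intervals [lo s, lo s + m s[ have the limit masses of the cells as lengths and
   are nested as the cells are; [idx D t] is the word of length [D] whose interval
   contains [t]. *)
Let lo := fix lo s :=
  if s is b :: s' then lo s' + (if b then m (false :: s') else 0) else 0.

Let idx := fix idx D (t : R) :=
  if D is D'.+1 then
    let s := idx D' t in (lo s + m (false :: s) <= t) :: s
  else [::].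

Let size_idx D t : size (idx D t) = D.
Proof. by elim: D => //= D ->. Qed.

Let itv s : set R := `[lo s, lo s + m s[.

Let in_itvs s t : itv s t = (lo s <= t < lo s + m s) :> Prop.
Proof. by rewrite /itv /= in_itv. Qed.

(** Each step of [idx] compares [t] with [lo s + m (false :: s)], the point at which [itv s] splits
    into the intervals of its two children. *)
Let itv_idx s t : (itv [::] t /\ idx (size s) t = s) <-> itv s t.
Proof.
elim: s => [|b s IH]; first by split=> [[]|].
split.
  move=> [t0 /= [bE ss]]; have /IH : itv [::] t /\ idx (size s) t = s by [].
  rewrite !in_itvs ss in bE *; move=> /andP[l1 l2].
  case: b bE => bE /=; first by rewrite bE -addrA -m_split.
  by rewrite addr0 l1 /= ltNge bE.
rewrite in_itvs /= => /andP[l1 l2].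
have : itv s t.
  rewrite in_itvs m_split; have := m_ge0 (false :: s); have := m_ge0 (true :: s).
  by case: b l1 l2; rewrite ?addr0 => l1 l2 ? ?; apply/andP; split; lra.
move=> /IH[t0 ->]; split=> //; congr cons.
case: b l1 l2; rewrite ?addr0 => // l1 l2.
by apply/negbTE; rewrite -ltNge.
Qed.

Let mitv s : measurable (itv s).
Proof. exact: measurable_itv. Qed.

Let rep s := xget x0 (cell A s).

Let pt D t := if `[< itv [::] t >] then rep (idx D t) else x0.

(** The default value of [rep] does not occur here: an empty cell has limit mass 0, hence an empty
    interval, whereas [t] lies in the interval of [idx D t]. *)
Let word_pt D t : itv [::] t -> word A D (pt D t) = idx D t.
Proof.
move=> t0; rewrite /pt asboolT //.
have : itv (idx D t) t by apply/itv_idx; rewrite size_idx.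
have [s0|/set0P[y sy] _] := eqVneq (cell A (idx D t)) set0.
  by rewrite in_itvs m_cell0 // addr0 => /andP[l1 l2]; have := le_lt_trans l1 l2; rewrite ltxx.
have : cell A (idx D t) (rep (idx D t)) by apply: xgetPex; exists y.
by rewrite {1}/cell /= size_idx.
Qed.

(* The points [pt D t] are chosen so that [pt E t] stays in the cell of [pt D t] for
   [E >= D], and the law of [pt D] gives to the cells of level [D] their limit masses. *)
Theorem skorokhod : exists (nu : {measure set (measurableTypeR R) -> \bar R})
    (pt : nat -> R -> T),
  [/\ (nu setT < +oo)%E,
      forall D (S : set T), measurable [set t : measurableTypeR R | S (pt D t)],
      forall D E t, (D <= E)%N -> word A D (pt E t) = word A D (pt D t) &
      forall s, fine (mu k (cell A s)) @[k --> U] -->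
        fine (nu [set t | cell A s (pt (size s) t)])].
Proof.
(* The interval [itv [::]] starts at 0 and its length is the limit of the total masses. *)
exists (mrestr lebesgue_measure (mitv [::])), pt; split.
- rewrite /= /mrestr setTI /itv /= lebesgue_measure_itv /=.
  by case: ifP => // _; rewrite -EFinB ltry.
(* The set [S] can be arbitrary: [pt D] is constant on each interval of level [D] and on the
   complement of [itv [::]], and there are countably many words. *)
- move=> D S.
  rewrite (_ : [set t | S (pt D t)] =
     (\bigcup_(s in setT) (if `[< S (rep s) /\ size s = D >] then itv s else set0)) `|`
     (if `[< S x0 >] then ~` itv [::] else set0)).
    apply: measurableU; last by case: ifP => // _; apply: measurableC; exact: mitv.
    apply: countable_bigcupT_measurable => [|s]; first exact: countableP.
    by case: ifP => // _; exact: mitv.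
  apply/seteqP; split=> t.
    rewrite /= /pt; case: asboolP => [t0 St|nt St]; last by right; rewrite asboolT.
    left; exists (idx D t) => //=; rewrite size_idx asboolT //.
    by apply/itv_idx; rewrite size_idx.
  rewrite /= /pt; case => [[s _]|].
    by case: asboolP => // -[Ss sD] /itv_idx[t0 ts]; rewrite asboolT // -sD ts.
  by case: asboolP => // Sx0 nt; rewrite asboolF.
- move=> D E t DE; have [t0|nt] := pselect (itv [::] t); last by rewrite /pt asboolF.
  rewrite (word_pt D) //; elim: E DE => [|E IH]; first by rewrite leqn0 => /eqP->; exact: word_pt.
  rewrite leq_eqVlt => /orP[/eqP->|]; first exact: word_pt.
  rewrite ltnS => DE; rewrite -IH //; apply: (word_le DE).
  have := word_pt E.+1 t0; rewrite /= => -[_ ->].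
  by rewrite word_pt.
- move=> s; rewrite [X in _ --> X](_ : _ = m s); first exact: m_cvg.
  rewrite /= /mrestr (_ : _ `&` _ = itv s).
    rewrite /itv /= lebesgue_measure_itv /=; case: ifP => [_|].
      by rewrite -EFinB /= addrC addKr.
    rewrite lte_fin ltrDl => /negbT; rewrite -leNgt => m0.
    by apply/esym/eqP; rewrite eq_le m0 m_ge0.
  apply/seteqP; split=> t.
    by move=> [ct t0]; apply/itv_idx; split=> //; rewrite -word_pt.
  by move=> /itv_idx[t0 ts]; split=> //; rewrite /cell /= word_pt.
Qed.

End skorokhod.

(** * Convergence of integrals along the Skorokhod points *)

Lemma bounded_integrable (R : realType) d (T : measurableType d)
    (mu : {measure set T -> \bar R}) (f : T -> R) : (mu setT < +oo)%E ->
  measurable_fun setT f -> (exists B, forall x, `|f x| <= B) ->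
  mu.-integrable setT (EFin \o f).
Proof.
move=> mufin mf [B fB]; apply: measurable_bounded_integrable => //.
exists B; split; first exact: num_real.
by move=> M BM x _ /=; apply: le_trans (ltW BM).
Qed.

Lemma Rintegral_dist_le (R : realType) d (T : measurableType d)
    (mu : {measure set T -> \bar R}) (f g : T -> R) (e : R) : (mu setT < +oo)%E ->
  mu.-integrable setT (EFin \o f) -> mu.-integrable setT (EFin \o g) ->
  (forall x, `|f x - g x| <= e) ->
  `|\int[mu]_x f x - \int[mu]_x g x| <= e * fine (mu setT).
Proof.
move=> mufin fi gi fg; rewrite -RintegralB //.
have fgi : mu.-integrable setT (EFin \o (fun x => f x - g x)).
  by have := integrableB measurableT fi gi; apply: eq_integrable.
apply: le_trans (le_normr_Rintegral _ _) _ => //.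
rewrite -Rintegral_cst //; apply: le_Rintegral => //.
- by have := integrable_abse fgi; apply: eq_integrable.
- by apply: (@bounded_integrable _ _ _ _ (cst e)) => //; exists `|e|.
Qed.

Lemma Rintegral_word (R : realType) d (T : measurableType d)
    (mu : {measure set T -> \bar R}) (w : T -> seq bool) D (G : seq bool -> R) :
  (mu setT < +oo)%E -> (forall t, size (w t) = D) ->
  (forall s, measurable [set t | w t = s]) ->
  mu.-integrable setT (EFin \o (G \o w)) /\
  \int[mu]_t G (w t) = \sum_(s : D.-tuple bool) G s * fine (mu [set t | w t = s]).
Proof.
move=> mufin sw mw.
have fin s : mu [set t | w t = s] \is a fin_num.
  rewrite ge0_fin_numE //; apply: le_lt_trans mufin; apply: le_measure => //.
  exact/mem_set/mw.
  exact/mem_set.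
have GE : EFin \o (G \o w) =
    fun t => (\sum_(s : D.-tuple bool) (G s)%:E * (\1_[set t | w t = s] t)%:E)%E.
  apply/funext => t /=; have wD : size (w t) == D by rewrite sw.
  rewrite (bigD1 (Tuple wD)) //= big1 ?adde0.
    by rewrite indicE mem_set //= mule1.
  move=> s sn; rewrite indicE memNset ?mule0 //= => ts; case/eqP: sn.
  by apply: val_inj; rewrite /= ts.
have ind s : mu.-integrable setT (fun t => (\1_[set t | w t = s] t)%:E).
  apply: (@bounded_integrable _ _ _ _ (fun t => \1_[set t | w t = s] t)) => //.
    exact: measurable_indic.
  by exists 1 => t; rewrite indicE; case: (_ \in _); rewrite ?normr1 ?normr0.
have Gi (s : D.-tuple bool) : mu.-integrable setT
    (fun t => (G s)%:E * (\1_[set t | w t = s] t)%:E)%E by apply: integrableZl => //.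
split; first by rewrite GE; apply: integrable_sum => //.
rewrite /Rintegral -[X in integral _ _ X]/(EFin \o (G \o w)) GE integral_sum //.
rewrite (eq_bigr (fun s : D.-tuple bool => (G s * fine (mu [set t | w t = s]))%:E)).
  by rewrite sumEFin.
move=> s _; rewrite integralZl // integral_indic // setIT EFinM fineK //.
Qed.

Section resolved.
Context (R : realType) (d : measure_display) (T : measurableType d) (x0 : T).
Context (A : nat -> set T).

(* [f] is bounded and is a uniform limit of functions of finitely many of the [A D]. *)
Definition resolved (f : T -> R) := (exists B, forall x, `|f x| <= B) /\
  forall e, 0 < e -> exists D, forall x y, word A D x = word A D y -> `|f x - f y| <= e.

Lemma resolved_cst c : resolved (fun=> c).
Proof.
split; first by exists `|c|.
by move=> e e0; exists 0%N => x y _; rewrite subrr normr0 ltW.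
Qed.

Lemma resolvedD f g : resolved f -> resolved g -> resolved (fun x => f x + g x).
Proof.
move=> [[B fB] fr] [[B' gB] gr]; split.
  by exists (B + B') => x; rewrite (le_trans (ler_normD _ _)) // lerD.
move=> e e0; have e20 : 0 < e / 2 by rewrite divr_gt0.
have [D fD] := fr _ e20; have [E gE] := gr _ e20.
exists (maxn D E) => x y xy.
rewrite opprD addrACA (le_trans (ler_normD _ _)) // (splitr e).
by apply: lerD; [apply: fD|apply: gE]; apply: word_le xy; rewrite ?leq_maxl ?leq_maxr.
Qed.

Lemma resolvedZ c f : resolved f -> resolved (fun x => c * f x).
Proof.
move=> [[B fB] fr]; split.
  by exists (`|c| * B) => x; rewrite normrM ler_wpM2l.
move=> e e0; have c0 : 0 < `|c| + 1 by rewrite ltr_wpDl.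
have [D fD] := fr _ (divr_gt0 e0 c0); exists D => x y xy.
rewrite -mulrBr normrM; apply: le_trans (_ : (`|c| + 1) * (e / (`|c| + 1)) <= _).
  by apply: ler_pM => //; [rewrite lerDl|exact: fD].
by rewrite mulrC divfK // gt_eqF.
Qed.

Lemma resolved_sum (I : Type) (r : seq I) (F : I -> T -> R) :
  (forall i, resolved (F i)) -> resolved (fun x => \sum_(i <- r) F i x).
Proof.
move=> Fr; elim: r => [|i r IH].
  by under eq_fun do rewrite big_nil; exact: resolved_cst.
by under eq_fun do rewrite big_cons; exact: resolvedD.
Qed.

Context (mu : nat -> {measure set T -> \bar R}) (C : R).
Hypothesis mu_le : forall k, (mu k setT <= C%:E)%E.
Hypothesis mA : forall D, measurable (A D).
Context (U : set_system nat) (UU : ProperFilter U).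
Context (nu : {measure set (measurableTypeR R) -> \bar R}) (pt : nat -> R -> T).
Hypothesis nu_fin : (nu setT < +oo)%E.
Hypothesis mpt :
  forall D (S : set T), measurable [set t : measurableTypeR R | S (pt D t)].
Hypothesis word_pt : forall D E t, (D <= E)%N -> word A D (pt E t) = word A D (pt D t).
Hypothesis cell_cvg : forall s, fine (mu k (cell A s)) @[k --> U] -->
  fine (nu [set t | cell A s (pt (size s) t)]).

(** The first [D] answers at [pt E t] no longer change once [E >= D], so the values of [f] form a
    Cauchy sequence. *)
Lemma resolved_cvg f t : resolved f -> cvgn (fun D => f (pt D t)).
Proof.
move=> [_ fr]; apply/cauchy_cvgP/cauchy_exP => e e0.
have [D fD] := fr _ (divr_gt0 e0 (ltr0Sn _ 1)).
exists (f (pt D t)); exists D => // E /= DE.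
rewrite /ball /=; apply: le_lt_trans (fD _ _ _) _; first by rewrite word_pt.
by rewrite ltr_pdivrMr // ltr_pMr // ltr1n.
Qed.

(** A substitute for the value of [f] at the limit of the points [pt D t]: [T] carries no topology
    in which they could converge. *)
Definition pt_lim (f : T -> R) t := limn (fun D => f (pt D t)).

Lemma pt_lim_dist f t D e :
  resolved f -> (forall x y, word A D x = word A D y -> `|f x - f y| <= e) ->
  `|pt_lim f t - f (pt D t)| <= e.
Proof.
move=> fr fD; have cf := @resolved_cvg f t fr.
have /cvgr_to_le : `|f (pt E t) - f (pt D t)| @[E --> \oo] --> `|pt_lim f t - f (pt D t)|.
  by apply: cvg_norm; apply: cvgB => //; exact: cvg_cst.
by apply; exists D => // E /= DE; apply: fD; rewrite word_pt.
Qed.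

Lemma measurable_pt_lim f : resolved f -> measurable_fun setT (pt_lim f).
Proof.
move=> fr; apply: (measurable_fun_cvg (h := fun D t => f (pt D t))).
  by move=> D _ Y mY; rewrite setTI; exact: (mpt D (f @^-1` Y)).
by move=> t _; exact: resolved_cvg.
Qed.

Lemma pt_lim_bounded f : resolved f -> exists B, forall t, `|pt_lim f t| <= B.
Proof.
move=> fr; have [[B fB] _] := fr; exists B => t.
have /cvgr_to_le : `|f (pt E t)| @[E --> \oo] --> `|pt_lim f t|.
  by apply: cvg_norm; exact: resolved_cvg.
by apply; exists 0%N => // E _.
Qed.

Lemma pt_lim_integrable f : resolved f -> nu.-integrable setT (EFin \o pt_lim f).
Proof.
move=> fr; apply: bounded_integrable => //; last exact: pt_lim_bounded.
exact: measurable_pt_lim.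
Qed.

(** Up to a small uniform error [f] is a function [G] of the first [D] answers. The integral of [G]
    is a finite combination of masses of cells, which converge by [cell_cvg]. *)
Theorem pt_lim_integral f : resolved f -> measurable_fun setT f ->
  \int[mu k]_x f x @[k --> U] --> \int[nu]_t pt_lim f t.
Proof.
move=> fr mf; have [fB fr'] := fr; apply/cvgrPdist_le => e e0.
pose N := fine (nu setT).
have mu_fin k : (mu k setT < +oo)%E by apply: le_lt_trans (mu_le k) (ltry _).
have N0 : 0 <= N by rewrite fine_ge0.
have C0 : 0 <= C by rewrite -lee_fin; apply: le_trans (mu_le 0%N); rewrite measure_ge0.
(* The three summands pay for replacing [f] by [G] under [mu k], for the two approximations from
   [pt_lim f] to [f (pt D t)] to [G] under [nu], and for the convergence of the integrals of [G]. *)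
have K0 : 0 < C + 2 * N + 1 by rewrite ltr_wpDl // addr_ge0 // mulr_ge0.
have [D fD] := fr' _ (divr_gt0 e0 K0); move: fD; set e' := e / _ => fD.
have e'0 : 0 < e' by exact: divr_gt0.
pose G s := f (xget x0 (cell A s)).
have fG x : `|f x - G (word A D x)| <= e'.
  apply: fD; have : cell A (word A D x) (xget x0 (cell A (word A D x))).
    by apply: xgetPex; exists x; rewrite /cell /= size_word.
  by rewrite {1}/cell /= size_word.
have mw s : measurable [set x | word A D x = s].
  have [sD|/eqP sD] := eqVneq (size s) D.
    rewrite (_ : [set x | _] = cell A s); first exact: measurable_cell.
    by rewrite /cell sD.
  rewrite (_ : [set x | _] = set0) //; apply/seteqP; split=> // x /= xs.
  by apply: sD; rewrite -xs size_word.
have [GiT GT] : (forall k, (mu k).-integrable setT (EFin \o (G \o word A D))) /\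
    forall k, \int[mu k]_x G (word A D x) =
      \sum_(s : D.-tuple bool) G s * fine (mu k (cell A s)).
  split=> k; have [GI GS] := Rintegral_word G (mu_fin k) (size_word A D) mw => //.
  rewrite GS; apply: eq_bigr => s _; rewrite /cell size_tuple //.
have [GiR GR] : nu.-integrable setT (EFin \o (G \o (fun t => word A D (pt D t)))) /\
    \int[nu]_t G (word A D (pt D t)) =
      \sum_(s : D.-tuple bool) G s * fine (nu [set t | cell A s (pt (size s) t)]).
  have [GI GS] := Rintegral_word G nu_fin (fun t => size_word A D (pt D t))
    (fun s => mpt D [set x | word A D x = s]).
  split=> //; rewrite GS; apply: eq_bigr => s _; rewrite /cell size_tuple //.
have : \int[mu k]_x G (word A D x) @[k --> U] --> \int[nu]_t G (word A D (pt D t)).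
  rewrite GR; under eq_cvg do rewrite GT.
  apply: cvg_big => [|s _]; first exact: add_continuous.
  by apply: cvgM; [exact: cvg_cst|exact: cell_cvg].
move/cvgrPdist_le => /(_ _ e'0); apply: filterS => k GG.
have d1 : `|\int[mu k]_x f x - \int[mu k]_x G (word A D x)| <= e' * C.
  apply: le_trans (Rintegral_dist_le (mu_fin k) _ (GiT k) fG) _.
    exact: bounded_integrable.
  rewrite ler_pM2l // -lee_fin fineK // ge0_fin_numE //.
have d2 : `|\int[nu]_t pt_lim f t - \int[nu]_t G (word A D (pt D t))| <= e' * 2 * N.
  apply: (Rintegral_dist_le nu_fin _ GiR); first exact: pt_lim_integrable.
  move=> t; rewrite mulr_natr mulr2n -(subrKA (f (pt D t))).
  by apply: le_trans (ler_normD _ _) _; rewrite lerD // pt_lim_dist.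
have -> : e = e' * (C + 2 * N + 1) by rewrite divfK // gt_eqF.
move: d1 d2 GG; set a := Rintegral _ _ f; set b := Rintegral _ _ _.
set c := Rintegral _ _ _; set g := Rintegral _ _ _ => d1 d2 d3.
rewrite !ler_norml in d1 d2 d3 *; apply/andP; split; nra.
Qed.

End resolved.

(** * Polynomials and cutoffs on R^n *)

Lemma Re_add (R : rcfType) (x y : R[i]) :
  complex.Re (x + y) = complex.Re x + complex.Re y.
Proof. by case: x y => [? ?] [? ?]. Qed.

Lemma Re_mulr (R : rcfType) (x : R[i]) (a : R) :
  complex.Re (x * a%:C) = complex.Re x * a.
Proof. by case: x => [u v] /=; rewrite mulr0 subr0. Qed.

Lemma continuous_bigsum (R : realType) (T : topologicalType) I (r : seq I)
    (F : I -> T -> R) :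
  (forall i, continuous (F i)) -> continuous (fun x => \sum_(i <- r) F i x).
Proof. by move=> cF x; apply: cvg_big => [|i _]; [exact: add_continuous|exact: cF]. Qed.

Lemma continuous_bigprod (R : realType) (T : topologicalType) I (r : seq I)
    (F : I -> T -> R) :
  (forall i, continuous (F i)) -> continuous (fun x => \prod_(i <- r) F i x).
Proof. by move=> cF x; apply: cvg_big => [|i _]; [exact: mul_continuous|exact: cF]. Qed.

Section polynomial_functions.
Context {R : realType} {n : nat}.
Implicit Types (P Q : mpoly n R[i]) (x : 'rV[R]_n).

Definition monomial_fun (m : multinom n) x : R := \prod_i (x 0 i) ^+ (m i).

Definition repeval P x : R := complex.Re (peval P x).

(** Continuous with compact support and increasing to 1 with [N]. The quadratic profile bounds
    [1 - cutoff N] by a polynomial divided by [N + 1], so that moments control the error of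
    truncation. *)
Definition cutoff N x : R := Num.max 0 (1 - (\sum_i (x 0 i) ^+ 2) / N.+1%:R).

Lemma repevalE P x :
  repeval P x = \sum_(m <- msupp P) complex.Re (mcoeff m P) * monomial_fun m x.
Proof.
rewrite /repeval /peval mevalE (big_morph _ (@Re_add R) (erefl _)).
apply: eq_bigr => m _; rewrite -Re_mulr; congr (complex.Re (_ * _)).
by rewrite /monomial_fun rmorph_prod; apply: eq_bigr => i _; rewrite rmorphXn.
Qed.

Lemma repeval1 x : repeval 1 x = 1.
Proof. by rewrite /repeval /peval meval1. Qed.

Lemma repevalD P Q x : repeval (P + Q) x = repeval P x + repeval Q x.
Proof. by rewrite /repeval /peval mevalD Re_add. Qed.

Lemma repeval_sqr P x : repeval (star P * P) x = Normc.normc (peval P x) ^+ 2.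
Proof.
rewrite /repeval /peval mevalM -/(peval (star P) x) -/(peval P x) peval_star.
case: (peval P x) => a b /=; rewrite sqr_sqrtr ?addr_ge0 ?sqr_ge0 //; ring.
Qed.

Lemma continuous_coord_pow (i : 'I_n) k : continuous (fun x : 'rV[R]_n => x 0 i ^+ k).
Proof.
move=> x; apply: (@continuous_comp _ _ _ (fun x : 'rV[R]_n => x 0 i) (fun a => a ^+ k)).
  exact: coord_continuous.
exact: exprn_continuous.
Qed.

Lemma continuous_monomial_fun m : continuous (monomial_fun m).
Proof. by apply: continuous_bigprod => i; exact: continuous_coord_pow. Qed.

Lemma continuous_repeval P : continuous (repeval P).
Proof.
rewrite (_ : repeval P = fun x =>
    \sum_(m <- msupp P) complex.Re (mcoeff m P) * monomial_fun m x).
  apply: continuous_bigsum => m x; apply: continuousM; first exact: cst_continuous.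
  exact: continuous_monomial_fun.
by apply/funext => x; exact: repevalE.
Qed.

Lemma continuous_cutoff N : continuous (cutoff N).
Proof.
move=> x; apply: (@continuous_max _ _ (fun=> 0 : R)
  (fun x => 1 - (\sum_i (x 0 i) ^+ 2) / N.+1%:R)); first exact: cst_continuous.
apply: continuousB; first exact: cst_continuous.
apply: continuousM; last exact: cst_continuous.
by apply: continuous_bigsum => i; exact: continuous_coord_pow.
Qed.

Lemma continuous_measurable (f : 'rV[R]_n -> R) : continuous f ->
  measurable_fun setT (f : borelRn -> R).
Proof.
move=> /continuousP cf; apply: (measurability _ (RGenOInfty.measurableE R)).
move=> _ [_ [a ->] <-]; rewrite setTI.
by apply: sub_sigma_algebra; apply: cf; exact: rray_open.
Qed.

Lemma cutoff_ge0 N x : 0 <= cutoff N x.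
Proof. by rewrite /cutoff le_max lexx. Qed.

Lemma cutoff_le1 N x : cutoff N x <= 1.
Proof.
rewrite /cutoff ge_max ler01 /= gerBl divr_ge0 // sumr_ge0 // => i _.
exact: sqr_ge0.
Qed.

Lemma cutoff_ge N x : 1 - cutoff N x <= (\sum_i (x 0 i) ^+ 2) / N.+1%:R.
Proof. by rewrite lerBlDl -lerBlDr /cutoff le_max lexx orbT. Qed.

Lemma bounded_monomial_cutoff m N :
  exists B, forall x, `|monomial_fun m x * cutoff N x| <= B.
Proof.
(* Where the cutoff is nonzero every coordinate has absolute value at most [N + 1], since otherwise
   its square would exceed [N + 1]. *)
exists (\prod_(i < n) N.+1%:R ^+ (m i)) => x.
have B0 : 0 <= \prod_(i < n) (N.+1%:R : R) ^+ (m i).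
  by apply: prodr_ge0 => i _; rewrite exprn_ge0.
rewrite normrM (ger0_norm (cutoff_ge0 _ _)).
have [->|/eqP c0] := eqVneq (cutoff N x) 0; first by rewrite mulr0.
apply: le_trans (_ : `|monomial_fun m x| <= _).
  by rewrite ler_piMr // cutoff_le1.
rewrite /monomial_fun normr_prod; apply: ler_prod => i _; rewrite normr_ge0 normrX /=.
apply: lerXn2r; rewrite ?nnegrE //.
rewrite leNgt; apply/negP => Nx; apply: c0; apply/eqP; rewrite eq_le cutoff_ge0 andbT.
rewrite /cutoff ge_max lexx /= subr_le0 ler_pdivlMr // mul1r.
rewrite (bigD1 i) //=.
have : N.+1%:R <= x 0 i ^+ 2.
  rewrite -real_normK ?num_real // expr2.
  apply: le_trans (ltW Nx) _; rewrite ler_peMl //.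
  by apply: le_trans (ltW Nx); rewrite ler1n.
by move=> h; apply: le_trans h _; rewrite lerDl sumr_ge0 // => j _; exact: sqr_ge0.
Qed.

End polynomial_functions.

(** * Resolution by sublevel sets and the limit measure on R^n *)

Lemma resolved_sublevels (R : realType) d (T : measurableType d) (A : nat -> set T) (f : T -> R) :
  (exists B, forall x, `|f x| <= B) ->
  (forall q : rat, exists d, A d = [set x | f x < ratr q]) -> resolved A f.
Proof.
move=> [B fB] /choice[c cP]; split; first by exists B.
(* The rationals [q 0, ..., q (2 J)] form a grid of step [1 / K < e] that covers the range of [f].
   The depth is chosen beyond all questions [f x < q i]. *)
move=> e e0; pose K : R := (Num.bound e^-1)%:R.
have eK : e^-1 < K by rewrite /K archi_boundP // invr_ge0 ltW.
have K0 : 0 < K by apply: lt_trans eK; rewrite invr_gt0.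
pose J := Num.bound (`|B| * K).
have BJ : `|B| * K < J%:R by rewrite archi_boundP // mulr_ge0 // ltW.
pose q i : rat := (i%:R - J%:R) / (Num.bound e^-1)%:R.
have qE i : ratr (q i) = (i%:R - J%:R) / K :> R.
  by rewrite /q fmorph_div rmorphB /= !ratr_nat.
exists (\max_(i < J.*2.+1) (c (q i)).+1)%N.
suff main x y : word A (\max_(i < J.*2.+1) (c (q i)).+1)%N x =
    word A (\max_(i < J.*2.+1) (c (q i)).+1)%N y -> f y - f x <= e.
  by move=> x y xy; rewrite ler_norml lerNl opprB !main.
move=> xy; rewrite leNgt; apply/negP => fyx.
have fy : `|f y * K| <= J%:R.
  rewrite normrM (gtr0_norm K0); apply: le_trans (ltW BJ); rewrite ler_pM2r //.
  by apply: le_trans (fB y) (ler_norm _).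
have [fy1 fy2] : - J%:R <= f y * K /\ f y * K <= J%:R by apply/andP; rewrite -ler_norml.
(* Here [q i] is the last grid point not above [f y]; if [f x < f y - e], then [f x < q i], and
   equal answers would give [f y < q i]. *)
have /Num.Theory.truncn_itv : 0 <= f y * K + J%:R by lra.
set i := Num.truncn _ => /andP[i1 i2].
have iJ : (i < J.*2.+1)%N.
  by rewrite ltnS -(ler_nat R) -muln2 natrM (le_trans i1) // mulr_natr mulr2n lerD2r.
have : (c (q i) < \max_(i < J.*2.+1) (c (q i)).+1)%N.
  exact: (@leq_bigmax _ (fun i : 'I_J.*2.+1 => (c (q i)).+1) (Ordinal iJ)).
move=> lt_c; have := word_in lt_c xy; rewrite cP /= qE => -[h _].
have : f y < (i%:R - J%:R) / K.
  apply: h; rewrite ltr_pdivlMr //.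
  have eK1 : 1 < e * K by rewrite mulrC -ltr_pdivrMr // div1r.
  rewrite -natr1 in i2; nra.
by rewrite ltr_pdivlMr // ltNge; lra.
Qed.

Section cut_sets.
Context {R : realType} {n : nat}.

(* Sublevel sets making all [monomial_fun m * cutoff N] resolved. *)
Definition cut_set (D : nat) : set (@borelRn R n) :=
  if @unpickle (multinom n * nat * rat)%type D is Some (m, N, q)
  then [set x | monomial_fun m x * cutoff N x < ratr q] else set0.

Lemma measurable_monomial_cutoff m N :
  measurable_fun setT (fun x : @borelRn R n => monomial_fun m x * cutoff N x).
Proof.
apply: continuous_measurable => x; apply: continuousM.
  exact: continuous_monomial_fun.
exact: continuous_cutoff.
Qed.

Lemma measurable_repeval P : measurable_fun setT (repeval P : @borelRn R n -> R).
Proof. by apply: continuous_measurable; exact: continuous_repeval. Qed.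

Lemma measurable_cutoff N : measurable_fun setT (cutoff N : @borelRn R n -> R).
Proof. by apply: continuous_measurable; exact: continuous_cutoff. Qed.

Lemma measurable_repeval_cutoff P N :
  measurable_fun setT (fun x : @borelRn R n => repeval P x * cutoff N x).
Proof. by apply: measurable_funM; [exact: measurable_repeval|exact: measurable_cutoff]. Qed.

Lemma measurable_cut_set D : measurable (cut_set D).
Proof.
rewrite /cut_set; case: unpickle => [[[m N] q]|] //.
rewrite (_ : [set x | _] = setT `&`
    (fun x => monomial_fun m x * cutoff N x) @^-1` `]-oo, (ratr q : R)[%classic).
  exact: measurable_monomial_cutoff.
by rewrite setTI; apply/seteqP; split => x /=; rewrite in_itv.
Qed.

Lemma resolved_monomial m N :
  resolved cut_set (fun x => monomial_fun m x * cutoff N x).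
Proof.
apply: resolved_sublevels; first exact: bounded_monomial_cutoff.
by move=> q; exists (pickle (m, N, q)); rewrite /cut_set pickleK.
Qed.

Lemma resolved_repeval P N : resolved cut_set (fun x => repeval P x * cutoff N x).
Proof.
rewrite (_ : (fun x => _) = fun x => \sum_(m <- msupp P)
    complex.Re (mcoeff m P) * (monomial_fun m x * cutoff N x)).
  by apply: resolved_sum => m; apply: resolvedZ; exact: resolved_monomial.
apply/funext => x; rewrite repevalE mulr_suml.
by apply: eq_bigr => m _; rewrite mulrA.
Qed.

Lemma resolved_cutoff N : resolved cut_set (cutoff N).
Proof.
have := resolved_repeval 1 N.
by under eq_fun do rewrite repeval1 mul1r.
Qed.

Lemma cvg_rV (I : Type) (F : set_system I) (FF : Filter F) (f : I -> 'rV[R]_n)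
    (a : 'rV[R]_n) :
  (forall i, f t 0 i @[t --> F] --> a 0 i) -> f @ F --> a.
Proof.
move=> fa B [P Pa PB].
have : F [set t | forall i, P 0 i (f t 0 i)].
  by apply: filter_forall => i; apply: fa; exact: Pa.
by move=> /filterS; apply=> t /= ft; apply: PB => i j; rewrite (ord1 i).
Qed.

End cut_sets.

Lemma le_divn_le0 (R : realType) (a K : R) :
  (forall N : nat, a <= K / N.+1%:R) -> a <= 0.
Proof.
move=> aK; rewrite leNgt; apply/negP => a0.
have K0 : 0 <= K by have := aK 0%N; rewrite divr1; apply: le_trans; exact: ltW.
have := aK (Num.bound (K / a)); rewrite ler_pdivlMr // mulrC -ler_pdivlMr //.
apply/negP; rewrite -ltNge; apply: lt_trans (_ : (Num.bound (K / a))%:R < _).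
  by rewrite archi_boundP // divr_ge0 // ltW.
by rewrite ltr_nat.
Qed.

(** For almost every [t] the Skorokhod points [pt D t] converge in R^n, and [nu] is the law of their
    limit. The second hypothesis is tightness: it makes the set of escaping [t] null. *)
Theorem cutoff_limit (R : realType) (n : nat)
    (mu : nat -> {measure set (@borelRn R n) -> \bar R}) (C K : R)
    (U : set_system nat) (UU : UltraFilter U) :
  (forall k, (mu k setT <= C%:E)%E) ->
  (forall N k, \int[mu k]_x (1 - cutoff N x) <= K / N.+1%:R) ->
  exists nu : {measure set (@borelRn R n) -> \bar R}, (nu setT < +oo)%E /\
    forall P N, \int[mu k]_x (repeval P x * cutoff N x) @[k --> U] -->
      \int[nu]_x (repeval P x * cutoff N x).
Proof.
move=> mu_le tight; have UP : ProperFilter U by exact: ultra_proper.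
have [la [pt [la_fin mpt word_pt cell_cvg]]] :=
  skorokhod (0 : borelRn) mu_le (@measurable_cut_set R n) UU.
pose c N t := pt_lim pt (cutoff N) t.
(* [good t] says that the points [pt D t] do not escape to infinity. *)
pose good t := exists N, 0 < c N t.
have pt_cutoff_cvg N t : cutoff N (pt D t) @[D --> \oo] --> c N t.
  exact: (resolved_cvg word_pt (resolved_cutoff N)).
have good_cvg t : good t -> cvgn (fun D => pt D t : 'rV[R]_n).
  move=> [N cN].
  (* A coordinate is unbounded and so not resolved; it is recovered as a quotient of two resolved
     functions, the denominator having the positive limit [c N t]. *)
  pose a i := pt_lim pt (fun x => monomial_fun (mnm1 i) x * cutoff N x) t.
  apply/cvg_ex; exists (\row_i (a i / c N t)); apply: cvg_rV => i; rewrite mxE.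
  have ai : monomial_fun (mnm1 i) (pt D t) * cutoff N (pt D t) @[D --> \oo] --> a i.
    exact: (resolved_cvg word_pt (resolved_monomial _ N)).
  have q : (monomial_fun (mnm1 i) (pt D t) * cutoff N (pt D t)) / cutoff N (pt D t)
      @[D --> \oo] --> a i / c N t.
    by apply: cvgM => //; apply: cvgV => //; rewrite gt_eqF.
  apply: cvg_trans q; apply: near_eq_cvg.
  have [D0 _ cD0] : \forall D \near \oo, 0 < cutoff N (pt D t).
    exact: (cvgr_gt _ (pt_cutoff_cvg N t)).
  exists D0 => // D /cD0 cD.
  rewrite mulfK ?gt_eqF // /monomial_fun (bigD1 i) //= mnmE eqxx expr1 big1 ?mulr1 //.
  by move=> j ji; rewrite mnmE eq_sym (negbTE ji).
pose X t : borelRn := if `[< good t >] then limn (fun D => pt D t : 'rV[R]_n) else 0.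
have X_cvg t : good t -> (pt D t : 'rV[R]_n) @[D --> \oo] --> (X t : 'rV[R]_n).
  by move=> gt; rewrite /X asboolT //; exact: good_cvg.
have mc N : measurable_fun setT (c N).
  exact: (measurable_pt_lim mpt word_pt (resolved_cutoff N)).
have mgood : measurable (good : set (measurableTypeR R)).
  rewrite (_ : good = \bigcup_N (setT `&` c N @^-1` `]0, +oo[%classic)).
    by apply: bigcupT_measurable => N; exact: mc.
  apply/seteqP; split=> [t [N cN]|t [N _ [_ cN]]]; exists N => //.
    by split=> //=; rewrite in_itv /= cN.
  by move: cN; rewrite /= in_itv /= andbT.
have mX : measurable_fun (setT : set (measurableTypeR R)) X.
  apply: (@measurability _ _ (measurableTypeR R) (@borelRn R n) setT X
    (@open 'rV[R]_n)) => // _ [W Wo <-]; rewrite setTI.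
  pose inW D j : set (measurableTypeR R) :=
    [set t | ball (pt D t : 'rV[R]_n) (j.+1%:R^-1 : R) `<=` W].
  (* [X t] lies in the open set [W] iff, for some [j], the balls of radius [1/(j+1)]
     about the [pt E t] are eventually contained in [W]. *)
  rewrite (_ : X @^-1` W =
    (good `&` \bigcup_j \bigcup_D \bigcap_(E in [set E | (D <= E)%N]) inW E j) `|`
    (if `[< W 0 >] then ~` good else set0)); last first.
    apply/seteqP; split=> t.
      have [gt|ngt] := pselect (good t) => /= XW; last first.
        by right; move: XW; rewrite /X asboolF // => W0; rewrite asboolT.
      left; split=> //.
      have : nbhs (X t : 'rV[R]_n) W by apply: open_nbhs_nbhs; split.
      rewrite -nbhs_ballE => -[e /= e0 eW].
      have [j je] : exists j : nat, j.+1%:R^-1 < e / 2 :> R.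
        exists (Num.bound (e / 2)^-1); rewrite invf_plt ?posrE ?divr_gt0 //.
        apply: lt_trans (_ : (Num.bound (e / 2)^-1)%:R < _); last by rewrite ltr_nat.
        by rewrite archi_boundP // invr_ge0 divr_ge0 // ltW.
      exists j => //.
      have /cvg_ballP/(_ (e / 2)) := X_cvg t gt.
      rewrite divr_gt0 // => /(_ isT)[D _ DX]; exists D => // E /= DE y ptEy.
      apply: eW; rewrite (splitr e); apply: (ball_triangle (DX E DE)).
      exact: le_ball (ltW je) _ ptEy.
    case=> [[gt [j _ [D _ DW]]]|].
      have /cvg_ballP/(_ j.+1%:R^-1) := X_cvg t gt.
      rewrite invr_gt0 ltr0Sn => /(_ isT)[E _ EX].
      apply: (DW (maxn D E)); first exact: leq_maxl.
      by apply: ball_sym; apply: EX; exact: leq_maxr.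
    by case: asboolP => // W0 ngt; rewrite /= /X asboolF.
  apply: measurableU; last by case: ifP => // _; exact: measurableC.
  apply: measurableI => //; apply: bigcupT_measurable => j.
  apply: bigcupT_measurable => D; apply: bigcap_measurable.
    by exists D => /=.
  move=> E _; exact: (mpt E (fun x => ball (x : 'rV[R]_n) (j.+1%:R^-1 : R) `<=` W)).
(* At a bad [t] every [c N t] is at most 0, so [1 - c N t] is at least 1. Its integral is the limit
   of the integrals of [1 - cutoff N], hence at most [K / (N + 1)] for every [N]. *)
have la_bad : la (~` good) = 0.
  have mbad : measurable (~` good : set (measurableTypeR R)) by exact: measurableC.
  have bad_fin : la (~` good) \is a fin_num.
    rewrite ge0_fin_numE //; apply: le_lt_trans la_fin; apply: le_measure => //.
      exact/mem_set.
    exact/mem_set.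
  rewrite -[LHS]fineK //; congr _%:E; apply/eqP; rewrite eq_le fine_ge0 // andbT.
  apply: (@le_divn_le0 _ _ K) => N.
  have r1 : resolved cut_set (fun x : @borelRn R n => 1 + -1 * cutoff N x).
    by apply: resolvedD; [exact: resolved_cst|apply: resolvedZ; exact: resolved_cutoff].
  have := pt_lim_integral (0 : borelRn) mu_le (@measurable_cut_set R n) UP la_fin mpt
    word_pt cell_cvg r1.
  have m1 : measurable_fun setT (fun x : @borelRn R n => 1 + -1 * cutoff N x).
    by apply: measurable_funD => //; apply: measurable_funM => //; exact: measurable_cutoff.
  move=> /(_ m1) /cvgr_to_le h; apply: le_trans (h (K / N.+1%:R) _); last first.
    apply: filterE => k; apply: le_trans (tight N k).
    by under eq_Rintegral do rewrite mulN1r.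
  have -> : fine (la (~` good)) = \int[la]_t \1_(~` good) t.
    by rewrite /Rintegral integral_indic // setIT.
  apply: le_Rintegral => //.
  - apply: (@bounded_integrable R _ (measurableTypeR R) la
      (\1_(~` good : set (measurableTypeR R)))) => //.
    by exists 1 => t; rewrite indicE; case: (_ \in _); rewrite ?normr1 ?normr0.
  - exact: (pt_lim_integrable la_fin mpt word_pt r1).
  - move=> t _; have -> : pt_lim pt (fun x => 1 + -1 * cutoff N x) t = 1 - c N t.
      apply: cvg_lim => //; under eq_cvg do rewrite mulN1r.
      by apply: cvgB; [exact: cvg_cst|exact: pt_cutoff_cvg].
    have c1 : c N t <= 1.
      by apply: (cvgr_to_le (pt_cutoff_cvg N t)); apply: filterE => D; exact: cutoff_le1.
    rewrite indicE; case: (boolP (t \in _)) => [|_]; last by rewrite subr_ge0.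
    rewrite inE /= => ngt; rewrite lerBrDl gerDr leNgt; apply/negP => cN.
    by apply: ngt; exists N.
unshelve eexists (pushforward la X); [exact: mX|split].
  by rewrite /= /pushforward preimage_setT.
move=> P N.
have mf := measurable_repeval_cutoff (n := n) P N.
have rf : resolved cut_set (fun x : @borelRn R n => repeval P x * cutoff N x) :=
  resolved_repeval P N.
have := pt_lim_integral (0 : borelRn) mu_le (@measurable_cut_set R n) UP la_fin mpt
  word_pt cell_cvg rf mf.
set f := fun x => _ in mf rf *.
rewrite [X in _ --> X -> _](_ : _ = Rintegral (pushforward la X) setT f) //.
have fX_int : la.-integrable setT ((EFin \o f) \o X).
  apply: (@bounded_integrable R _ (measurableTypeR R) la (f \o X)) => //.
    exact: measurableT_comp.
  by have [[B fB] _] := rf; exists B => t; exact: fB.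
have mEf : measurable_fun setT (EFin \o f) by exact/measurable_EFinP.
have := @integral_pushforward _ _ (measurableTypeR R) (@borelRn R n) R X mX la setT
  (EFin \o f) mEf.
rewrite preimage_setT => /(_ fX_int measurableT) push.
(* Off the null set of bad points, [pt_lim pt f t = f (X t)] because [f] is continuous and [pt D t]
   tends to [X t]. *)
congr fine; rewrite [RHS]push; apply: ae_eq_integral => //.
- by apply/measurable_EFinP; exact: (measurable_pt_lim mpt word_pt rf).
- by case/integrableP: fX_int.
exists (~` good); split => //; first exact: measurableC.
move=> t /=; apply: contra_not => gt _ /=; congr EFin; apply: cvg_lim => //.
have cf : continuous (f : 'rV[R]_n -> R).
  by move=> x; apply: continuousM; [exact: continuous_repeval|exact: continuous_cutoff].
by apply: (@continuous_cvg _ _ _ \oo _ (fun D => pt D t : 'rV[R]_n)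
  (f : 'rV[R]_n -> R) (X t)); [exact: cf|exact: X_cvg].
Qed.

(** * Pointwise limits of moment functionals *)

Section cutoff_error.
Context {R : realType} {n : nat}.
Implicit Types (P Q : mpoly n R[i]) (x : 'rV[R]_n).

Definition normsq_poly : mpoly n R[i] := \sum_i mpolyX R[i] (mnm1 i) ^+ 2.

(* With [s = \sum x_i^2], [|Re P| s <= |P|^2 + s^2] bounds the error of a cutoff. *)
Definition majorant P : mpoly n R[i] :=
  star P * P + star normsq_poly * normsq_poly.

Lemma peval_normsq x : peval normsq_poly x = (\sum_i (x 0 i) ^+ 2)%:C.
Proof.
rewrite /peval /normsq_poly !rmorph_sum; apply: eq_bigr => i _ /=.
by rewrite !rmorphXn /= mevalXU.
Qed.

Lemma repeval_normsq x : repeval normsq_poly x = \sum_i (x 0 i) ^+ 2.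
Proof. by rewrite /repeval peval_normsq. Qed.

Lemma normc_real (a : R) : Normc.normc a%:C = `|a|.
Proof. by rewrite /= expr0n /= addr0 sqrtr_sqr. Qed.

Lemma Re_le_normc (z : R[i]) : `|complex.Re z| <= Normc.normc z.
Proof.
case: z => a b /=; rewrite -sqrtr_sqr ler_wsqrtr // lerDl; exact: sqr_ge0.
Qed.

Lemma cutoff_dist_le P N x :
  `|repeval P x - repeval P x * cutoff N x| <= repeval (majorant P) x / N.+1%:R.
Proof.
rewrite -{1}[repeval P x]mulr1 -mulrBr normrM (ger0_norm (x := 1 - _)); last first.
  by rewrite subr_ge0 cutoff_le1.
apply: le_trans (_ : `|repeval P x| * ((\sum_i (x 0 i) ^+ 2) / N.+1%:R) <= _).
  by rewrite ler_wpM2l // cutoff_ge.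
rewrite mulrA ler_wpM2r // ?invr_ge0 // repevalD !repeval_sqr peval_normsq normc_real.
set s := \sum_i _; have s0 : 0 <= s by rewrite sumr_ge0 // => i _; exact: sqr_ge0.
rewrite (ger0_norm s0); have := Re_le_normc (peval P x); rewrite -/(repeval P x).
have := normr_ge0 (repeval P x); set a := `|_|; set b := Normc.normc _ => a0 ab.
(* The chain is [a * s <= b * s <= 2 * b * s <= b ^ 2 + s ^ 2]. *)
have : 0 <= (b - s) ^+ 2 by exact: sqr_ge0.
have : 0 <= (b - a) * s by rewrite mulr_ge0 // subr_ge0.
have : 0 <= b * s by rewrite mulr_ge0 // (le_trans a0).
nra.
Qed.

Lemma integrable_repeval_cutoff (mu : {measure set (@borelRn R n) -> \bar R}) P N :
  mu.-integrable setT (EFin \o repeval P) ->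
  mu.-integrable setT (EFin \o (fun x : borelRn => repeval P x * cutoff N x)).
Proof.
apply: le_integrable => //; first by apply/measurable_EFinP; exact: measurable_repeval_cutoff.
move=> x _ /=; rewrite lee_fin normrM (ger0_norm (cutoff_ge0 _ _)).
by rewrite ler_piMr // cutoff_le1.
Qed.

(** The bound sees [mu] only through a moment, so it passes to the limit along measures with
    converging moments. *)
Lemma cutoff_error (mu : {measure set (@borelRn R n) -> \bar R}) P N :
  (forall Q, mu.-integrable setT (EFin \o repeval Q)) ->
  `|\int[mu]_x repeval P x - \int[mu]_x (repeval P x * cutoff N x)| <=
    (\int[mu]_x repeval (majorant P) x) / N.+1%:R.
Proof.
move=> int; have intc := integrable_repeval_cutoff N (int P).
rewrite -RintegralB // -RintegralZr //.
have intB : mu.-integrable setT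
    (EFin \o (fun x : borelRn => repeval P x - repeval P x * cutoff N x)).
  by have := integrableB measurableT (int P) intc; apply: eq_integrable.
apply: le_trans (le_normr_Rintegral _ _) _ => //; apply: le_Rintegral => //.
- by have := integrable_abse intB; apply: eq_integrable.
- have := integrableZr measurableT N.+1%:R^-1 (int (majorant P)).
  by apply: eq_integrable.
- by move=> x _; exact: cutoff_dist_le.
Qed.

Lemma cvg_cutoff x : cutoff N x @[N --> \oo] --> (1 : R).
Proof.
pose s := \sum_i (x 0 i) ^+ 2.
apply: (@squeeze_cvgr _ _ _ _ (fun N => 1 - s * harmonic N) (fun=> 1)).
- apply: filterE => N; rewrite cutoff_le1 andbT lerBlDl -lerBlDr; exact: cutoff_ge.
- rewrite -[X in _ --> X]subr0 -[X in _ - X](mulr0 s).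
  by apply: cvgB; [exact: cvg_cst|apply: cvgM; [exact: cvg_cst|exact: cvg_harmonic]].
- exact: cvg_cst.
Qed.

Lemma cutoff_nondecreasing x : {homo (fun N => cutoff N x) : N M / (N <= M)%N >-> N <= M}.
Proof.
move=> N M NM; rewrite /cutoff ge_max !le_max lexx /=; apply/orP; right.
rewrite lerD2l lerN2 ler_wpM2l //.
  by rewrite sumr_ge0 // => i _; exact: sqr_ge0.
by rewrite lef_pV2 ?posrE // ler_nat.
Qed.

(** Monotone convergence, as the cutoffs increase to 1. The conclusion concerns the extended
    integral because integrability is still to be derived from it. *)
Lemma integral_sqr_le (mu : {measure set (@borelRn R n) -> \bar R}) Q c :
  (mu setT < +oo)%E ->
  (forall N, \int[mu]_x (repeval (star Q * Q) x * cutoff N x) <= c) ->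
  (\int[mu]_x (repeval (star Q * Q) x)%:E <= c%:E)%E.
Proof.
move=> mufin le_c; pose g N (x : @borelRn R n) := (repeval (star Q * Q) x * cutoff N x)%:E.
have sq0 x : 0 <= repeval (star Q * Q) x by rewrite repeval_sqr sqr_ge0.
have g0 N x : (0 <= g N x)%E by rewrite lee_fin mulr_ge0 // cutoff_ge0.
have mg N : measurable_fun setT (g N).
  by apply/measurable_EFinP; exact: measurable_repeval_cutoff.
have glim x : limn (g^~ x) = (repeval (star Q * Q) x)%:E.
  apply/cvg_lim => //; apply: cvg_EFin; first by apply: filterE => N.
  rewrite -[X in _ --> X]mulr1; apply: cvgM; first exact: cvg_cst.
  exact: cvg_cutoff.
have nd x : {homo g^~ x : N M / (N <= M)%N >-> (N <= M)%E}.
  by move=> N M NM; rewrite lee_fin ler_wpM2l // cutoff_nondecreasing.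
have gint N : (\int[mu]_x g N x <= c%:E)%E.
  have : mu.-integrable setT (g N).
    have [[B fB] _] := resolved_repeval (star Q * Q) N.
    apply: (@bounded_integrable _ _ _ mu
      (fun x : @borelRn R n => repeval (star Q * Q) x * cutoff N x)) => //.
      exact: measurable_repeval_cutoff.
    by exists B.
  move=> /(integrable_fin_num measurableT) /fineK <-; rewrite lee_fin; exact: le_c.
have := monotone_convergence mu measurableT mg (fun N x _ => g0 N x) (fun x _ => nd x).
rewrite (_ : \int[mu]_x limn (g^~ x) = \int[mu]_x (repeval (star Q * Q) x)%:E)%E; last first.
  by apply: eq_integral => x _; exact: glim.
move=> ->; apply: lime_le; last by apply: filterE.
apply: ereal_nondecreasing_is_cvgn => N M NM; apply: ge0_le_integral => //.
by move=> x _; exact: nd.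
Qed.

End cutoff_error.

Section closedness.
Context {R : realType} {n : nat}.
Implicit Types (P Q : mpoly n R[i]) (x : 'rV[R]_n).

Lemma normc_peval P x : Normc.normc (peval P x) = Num.sqrt (repeval (star P * P) x).
Proof.
rewrite repeval_sqr sqrtr_sqr ger0_norm //.
by case: (peval P x) => a b; exact: sqrtr_ge0.
Qed.

Lemma measurable_normc_peval P :
  measurable_fun setT (fun x : @borelRn R n => Normc.normc (peval P x)).
Proof.
under eq_fun do rewrite normc_peval.
apply: continuous_measurable => x.
apply: (@continuous_comp _ _ _ (repeval (star P * P)) (@Num.sqrt R)).
  exact: continuous_repeval.
exact: sqrt_continuous.
Qed.

Lemma integrable_repeval (mu : {measure set (@borelRn R n) -> \bar R}) P :
  (\int[mu]_x (Normc.normc (peval P x))%:E < +oo)%E ->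
  mu.-integrable setT (EFin \o repeval P).
Proof.
move=> fin; apply/integrableP; split.
  by apply/measurable_EFinP; exact: measurable_repeval.
apply: le_lt_trans fin; apply: ge0_le_integral => //.
- by apply: measurableT_comp => //; apply/measurable_EFinP; exact: measurable_repeval.
- by apply/measurable_EFinP; exact: measurable_normc_peval.
- by move=> x _ /=; rewrite lee_fin; exact: Re_le_normc.
Qed.

Lemma repeval_mulI P x : repeval ('i *: P) x = - complex.Im (peval P x).
Proof.
rewrite /repeval /peval mevalZ -/(peval P x).
by case: (peval P x) => a b /=; rewrite mul0r mul1r sub0r.
Qed.

(** Real parts suffice: the imaginary part at [P] is minus the real part at ['i *: P]. *)
Lemma moment_functionalP (L : {scalar mpoly n R[i]}) :
  moment_functional L <->
  exists mu : {measure set (@borelRn R n) -> \bar R},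
    (forall P, (\int[mu]_x (Normc.normc (peval P x))%:E < +oo)%E) /\
    (forall P, \int[mu]_x repeval P x = complex.Re (L P)).
Proof.
split=> -[mu [fin Lmu]]; exists mu; split=> // P; first by rewrite Lmu.
have := Lmu P; have := Lmu ('i *: P); rewrite linearZ /=.
rewrite (_ : complex.Re ('i * L P) = - complex.Im (L P)); last first.
  by case: (L P) => a b /=; rewrite mul0r mul1r sub0r.
under eq_Rintegral do rewrite repeval_mulI.
move=> ImP ReP; rewrite [LHS]complexE [RHS]complexE /= ReP; congr (_ + _ * _%:C).
apply: oppr_inj; rewrite -ImP -mulN1r -RintegralZl //.
  by apply: eq_Rintegral => x _; rewrite mulN1r.
have := integrableZl measurableT (-1) (integrable_repeval (fin ('i *: P))).
apply: eq_integrable => // x _ /=; rewrite -EFinM repeval_mulI mulN1r opprK //.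
Qed.

Theorem moment_functional_closed (L : {scalar mpoly n R[i]})
    (Lk : nat -> {scalar mpoly n R[i]}) :
  (forall k, moment_functional (Lk k)) ->
  (forall P, complex.Re (Lk k P) @[k --> \oo] --> complex.Re (L P)) ->
  moment_functional L.
Proof.
move=> Lk_moment Lk_cvg.
have /choice[mu mu_Lk] : forall k, exists mu : {measure set (@borelRn R n) -> \bar R},
    (forall P, (\int[mu]_x (Normc.normc (peval P x))%:E < +oo)%E) /\
    (forall P, \int[mu]_x repeval P x = complex.Re (Lk k P)).
  by move=> k; apply/moment_functionalP.
have mu_int k P : (mu k).-integrable setT (EFin \o repeval P).
  exact: integrable_repeval ((mu_Lk k).1 P).
have muE k P : \int[mu k]_x repeval P x = complex.Re (Lk k P) := (mu_Lk k).2 P.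
have bound P : exists B, forall k, complex.Re (Lk k P) <= B.
  have /cvg_seq_bounded : cvgn (fun k => complex.Re (Lk k P)).
    by apply/cvg_ex; exists (complex.Re (L P)).
  move=> [M [_ /(_ (M + 1))]]; rewrite ltrDl ltr01 => /(_ isT) hM.
  by exists (M + 1) => k; apply: le_trans (ler_norm _) _; exact: hM.
have [C LC] := bound 1; have [K LK] := bound normsq_poly.
have mu_le k : (mu k setT <= C%:E)%E.
  have <- : (\int[mu k]_x (repeval 1 x)%:E = mu k setT)%E.
    under eq_integral do rewrite repeval1.
    by rewrite integral_cst // mul1e.
  rewrite -[leLHS]fineK; last exact: integrable_fin_num (mu_int k 1).
  by rewrite lee_fin; apply: le_trans (LC k); rewrite -muE.
have mu_fin k : (mu k setT < +oo)%E by apply: le_lt_trans (mu_le k) (ltry _).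
have tight N k : \int[mu k]_x (1 - cutoff N x) <= K / N.+1%:R.
  apply: le_trans (_ : \int[mu k]_x (repeval normsq_poly x / N.+1%:R) <= _).
    apply: le_Rintegral => //.
    - apply: (@bounded_integrable _ _ _ (mu k) (fun x : borelRn => 1 - cutoff N x)) => //.
        by apply: measurable_funB => //; exact: measurable_cutoff.
      exists 1 => x; rewrite ger0_norm ?subr_ge0 ?cutoff_le1 //.
      by rewrite gerBl cutoff_ge0.
    - have := integrableZr measurableT N.+1%:R^-1 (mu_int k normsq_poly).
      by apply: eq_integrable.
    - by move=> x _; rewrite repeval_normsq; exact: cutoff_ge.
  by rewrite RintegralZr // muE ler_wpM2r // invr_ge0.
have [U [UU oo_U]] := ultraFilterLemma eventually_filter.
have UP : ProperFilter U by exact: ultra_proper.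
have Lk_cvgU P : complex.Re (Lk k P) @[k --> U] --> complex.Re (L P).
  by move=> B LB; apply: oo_U; exact: Lk_cvg.
have [nu [nu_fin nu_cvg]] := cutoff_limit UU mu_le tight.
(* For each [mu k] inserting a cutoff only lowers the integral of the square, and the limits along
   [U] inherit the inequality. *)
have nu_sqr P : (\int[nu]_x (repeval (star P * P) x)%:E
    <= (complex.Re (L (star P * P)%R))%:E)%E.
  apply: integral_sqr_le => // N; apply: ler_cvg_to (nu_cvg _ N) (Lk_cvgU _) _.
  apply: filterE => k; rewrite -muE; apply: le_Rintegral => //.
    exact: integrable_repeval_cutoff.
  move=> x _; rewrite ler_piMr ?cutoff_le1 // repeval_sqr; exact: sqr_ge0.
have nu_normc P : (\int[nu]_x (Normc.normc (peval P x))%:E < +oo)%E.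
  (* A modulus is at most 1 plus its square. *)
  apply: le_lt_trans (_ : \int[nu]_x (1 + (repeval (star P * P) x)%:E) < +oo)%E.
    apply: ge0_le_integral => //.
    - by move=> x _; rewrite lee_fin normc_peval sqrtr_ge0.
    - by apply/measurable_EFinP; exact: measurable_normc_peval.
    - apply: emeasurable_funD => //; apply/measurable_EFinP; exact: measurable_repeval.
    - move=> x _; rewrite -(EFinD 1) lee_fin repeval_sqr.
      set a := Normc.normc _; have := sqr_ge0 (a - 1); nra.
  rewrite ge0_integralD //.
  - rewrite integral_cst // mul1e lte_add_pinfty //.
    by apply: le_lt_trans (nu_sqr P) (ltry _).
  - by move=> x _; rewrite lee_fin repeval_sqr sqr_ge0.
  - by apply/measurable_EFinP; exact: measurable_repeval.
have nu_int P := integrable_repeval (nu_normc P).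
apply/moment_functionalP; exists nu; split=> // P.
(* One summand bounds the cutoff error under [nu], the other the limit of the cutoff errors under
   [mu k]; the sum over [N + 1] tends to 0. *)
apply/eqP; rewrite -subr_eq0 -normr_le0; apply/(@le_divn_le0 _ _
  (\int[nu]_x repeval (majorant P) x + complex.Re (L (majorant P)))) => N.
rewrite -(subrKA (\int[nu]_x (repeval P x * cutoff N x))) mulrDl.
apply: le_trans (ler_normD _ _) _; apply: lerD; first exact: cutoff_error.
have lhs : `|\int[mu k]_x (repeval P x * cutoff N x) - complex.Re (Lk k P)| @[k --> U]
    --> `|\int[nu]_x (repeval P x * cutoff N x) - complex.Re (L P)|.
  by apply: cvg_norm; apply: cvgB; [exact: nu_cvg|exact: Lk_cvgU].
have rhs : complex.Re (Lk k (majorant P)) / N.+1%:R @[k --> U]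
    --> complex.Re (L (majorant P)) / N.+1%:R.
  by apply: cvgM; [exact: Lk_cvgU|exact: cvg_cst].
apply: (ler_cvg_to lhs rhs).
apply: filterE => k; rewrite -!muE distrC; exact: cutoff_error.
Qed.

End closedness.

(** * Positive definite functionals *)

Section positive_definite.
Context {R : realType} {n : nat}.
Implicit Types (P Q S : mpoly n R[i]) (x : 'rV[R]_n) (L : {scalar mpoly n R[i]}).

Lemma starK P : star (star P) = P.
Proof. by apply/mpolyP => m; rewrite !mcoeff_map_mpoly /= conjcK. Qed.

Lemma starD P Q : star (P + Q) = star P + star Q.
Proof. exact: rmorphD. Qed.

Lemma starZ (c : R[i]) P : star (c *: P) = conjc c *: star P.
Proof. exact: map_mpolyZ. Qed.

Lemma affine_ge0_eq0 (a z : R[i]) : (forall t : R, 0 <= a + t%:C * z) -> z = 0.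
Proof.
case: a z => [a b] [u v] h.
have {}h (t : R) : b + t * v = 0 /\ 0 <= a + t * u.
  by have := h t; rewrite lecE /= !mul0r subr0 addr0 => /andP[/eqP -> ->].
have v0 : v = 0.
  by have [h0 _] := h 0; have [h1 _] := h 1; move: h0 h1; rewrite mul0r mul1r; lra.
suff u0 : u = 0 by rewrite u0 v0.
(* At this [t] the real part would be -1. *)
apply/eqP; apply: contraT => u0; have [_] := h (- (a + 1) / u).
by rewrite divfK //; lra.
Qed.

(** The term quadratic in [c] drops out because [L (star P * P) = 0], and an affine function of a
    real variable that stays nonnegative is constant. *)
Lemma positive_definite_cauchy_schwarz L P : positive_definite L ->
  L (star P * P) = 0 -> forall S, L (S * P) = 0.
Proof.
move=> Lpos LP S.
(* Positivity of [L] at [S^* + c P], for [c] real and then purely imaginary. *)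
have h (c : R[i]) :
    0 <= L (S * star S) + (c * L (S * P) + conjc c * L (star P * star S)).
  have := Lpos (star S + c *: P).
  rewrite starD starZ starK mulrDl !mulrDr -!scalerAl -!scalerAr !linearD !linearZ /=.
  by rewrite LP !mulr0 addr0 addrA.
have h1 : L (S * P) + L (star P * star S) = 0.
  apply: (@affine_ge0_eq0 (L (S * star S))) => t.
  have := h t%:C.
  by rewrite conjc_real mulrDr.
have h2 : 'i * (L (S * P) - L (star P * star S)) = 0.
  apply: (@affine_ge0_eq0 (L (S * star S))) => t; have := h (t%:C * 'i).
  rewrite (_ : conjc (t%:C * 'i) = - (t%:C * 'i)); last by simpc.
  by rewrite mulNr -mulrBr mulrA.
have i0 : ('i : R[i]) != 0 by rewrite eq_complex /= oner_eq0 andbF.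
move/eqP: h2; rewrite mulf_eq0 (negbTE i0) /= subr_eq0 => /eqP h2.
by move/eqP: h1; rewrite -h2 -mulr2n mulrn_eq0 => /eqP.
Qed.

(** * Functionals of atomic measures with dense atoms *)

Lemma scalar_pack (f : mpoly n R[i] -> R[i]) :
  (forall (c : R[i]) P Q, f (c *: P + Q) = c * f P + f Q) ->
  exists L, forall P, L P = f P.
Proof.
move=> fl; pose m := GRing.isLinear.Build _ _ _ _ f fl.
by exists (HB.pack_for {scalar mpoly n R[i]} f m).
Qed.

(** [V] may lack rational points, so a point of [V] is chosen in each small ball with rational
    centre that meets [V]; for the other balls the default [v] keeps the sequence in [V]. *)
Lemma dense_sequence (V : set 'rV[R]_n) : V !=set0 ->
  exists z : nat -> 'rV[R]_n, (forall k, V (z k)) /\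
    forall P, (forall k, peval P (z k) = 0) -> forall x, V x -> peval P x = 0.
Proof.
move=> [v Vv].
pose B (q : 'rV[rat]_n) (j : nat) :=
  V `&` ball (map_mx ratr q : 'rV[R]_n) (j.+1%:R^-1 : R).
pose z k := if @unpickle ('rV[rat]_n * nat)%type k is Some (q, j)
  then xget v (B q j) else v.
have Vz k : V (z k).
  rewrite /z; case: unpickle => [[q j]|//].
  by case: (xgetP v (B q j)) => [y _ []|].
exists z; split=> // P Pz x Vx; apply/eqP; apply: contraT => Px.
have rP : 0 < repeval (star P * P) x.
  rewrite repeval_sqr exprn_gt0 // lt_neqAle eq_sym normc_peval sqrtr_ge0 andbT -normc_peval.
  by apply: contra_neq Px; exact: Normc.eq0_normc.
(* With the value at [x] itself as tolerance, the squared modulus cannot vanish near [x]. *)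
have /cvgrPdist_lt/(_ _ rP) := @continuous_repeval R n (star P * P) x.
rewrite -nbhs_ballE => -[e /= e0 eP].
have [j je] : exists j : nat, j.+1%:R^-1 < e / 2 :> R.
  exists (Num.bound (e / 2)^-1); rewrite invf_plt ?posrE ?divr_gt0 //.
  apply: lt_trans (_ : (Num.bound (e / 2)^-1)%:R < _); last by rewrite ltr_nat.
  by rewrite archi_boundP // invr_ge0 divr_ge0 // ltW.
have j0 : 0 < j.+1%:R^-1 :> R by rewrite invr_gt0.
have /choice[q qP] : forall i, exists q : rat, `|x 0 i - ratr q| < j.+1%:R^-1.
  move=> i; have [|q] := @rat_in_itvoo R (x 0 i) (x 0 i + j.+1%:R^-1).
    by rewrite ltrDl.
  rewrite in_itv /= => /andP[q1 q2]; exists q.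
  by rewrite distrC gtr0_norm ?subr_gt0 // ltrBlDl.
have Bx : B (\row_i q i) j x.
  split=> //; apply: ball_sym; split=> // i i'.
  by rewrite !mxE (ord1 i); exact: qP.
have /eP : ball x e (z (pickle (\row_i q i, j))).
  rewrite /z pickleK; have [_ bz] := xgetPex v (ex_intro _ x Bx).
  apply: (le_ball (ltW _)) (ball_triangle (ball_sym Bx.2) bz).
  by rewrite (splitr e) ltrD.
by rewrite /= (repeval_sqr P (z _)) Pz Normc.normc0 expr0n /= subr0 ger0_norm ?ltxx // ltW.
Qed.

End positive_definite.

Lemma complex_scale (R : rcfType) (V : lmodType R[i]) (a b : R) (v : V) :
  (a +i* b) *: v = a%:C *: v + b%:C *: ('i *: v).
Proof. by rewrite scalerA -scalerDl; congr (_ *: _); simpc. Qed.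

Lemma scale_ii (R : rcfType) (V : lmodType R[i]) (v : V) :
  'i *: ('i *: v) = (-1)%:C *: v.
Proof. by rewrite scalerA; congr (_ *: _); simpc. Qed.

Lemma scaler_swap (R : comPzRingType) (V : lmodType R) (a b : R) (v : V) :
  a *: (b *: v) = b *: (a *: v).
Proof. by rewrite !scalerA mulrC. Qed.

Lemma complex_affine (R : rcfType) (a b p ip q iq : R) :
  (a * p + b * ip + q) +i* - (a * ip + b * - p + iq) =
  (a +i* b) * (p +i* - ip) + (q +i* - iq).
Proof. by apply/eqP; rewrite eq_complex /=; apply/andP; split; apply/eqP; ring. Qed.

Section atomic_functional.
Context {R : realType} {n : nat}.
Implicit Types (P Q S : mpoly n R[i]) (x : 'rV[R]_n) (L : {scalar mpoly n R[i]}).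

(** A real-linear functional is the real part of a complex-linear one, whose imaginary part is
    forced by its value at ['i *: P]. *)
Lemma complexify (lam : mpoly n R[i] -> R) :
  (forall P Q, lam (P + Q) = lam P + lam Q) ->
  (forall (a : R) P, lam (a%:C *: P) = a * lam P) ->
  exists L, forall P, L P = lam P +i* - lam ('i *: P).
Proof.
move=> lamD lamZ.
have lamC a b P : lam ((a +i* b) *: P) = a * lam P + b * lam ('i *: P).
  by rewrite complex_scale lamD !lamZ.
have lamI P : lam ('i *: ('i *: P)) = - lam P.
  by rewrite scale_ii (lamZ (-1)) mulN1r.
apply: scalar_pack => -[a b] P Q.
have lamM : lam ((a +i* b) *: P + Q) = a * lam P + b * lam ('i *: P) + lam Q.
  by rewrite lamD lamC.
have lamMI : lam ('i *: ((a +i* b) *: P + Q)) =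
    a * lam ('i *: P) + b * - lam P + lam ('i *: Q).
  by rewrite scalerDr lamD (scaler_swap 'i) lamC lamI.
rewrite lamM lamMI; exact: complex_affine.
Qed.

Lemma repevalZ (a : R) P x : repeval (a%:C *: P) x = a * repeval P x.
Proof.
rewrite /repeval /peval mevalZ; case: (meval _ _) => c d /=.
by rewrite mul0r subr0.
Qed.

Lemma repeval_sum (I : Type) (r : seq I) (F : I -> mpoly n R[i]) x :
  repeval (\sum_(i <- r) F i) x = \sum_(i <- r) repeval (F i) x.
Proof.
apply: (big_morph (fun P => repeval P x)) => [P Q|]; first exact: repevalD.
by rewrite /repeval /peval meval0.
Qed.

Lemma summable_weights (z : nat -> 'rV[R]_n) : exists w : nat -> R,
  (forall k, 0 < w k) /\
  forall P, cvgn (series (fun k => w k * repeval P (z k))).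
Proof.
(* [w k] is damped by the values at [z k] of the first [k + 1] monomials, so that each
   monomial is dominated by a geometric sequence from some rank on. *)
pose b (j k : nat) : R := if @unpickle (multinom n) j is Some m
  then `|monomial_fun m (z k)| else 0.
have b0 j k : 0 <= b j k by rewrite /b; case: unpickle.
pose s k := \sum_(j < k.+1) b j k.
have s0 k : 0 <= s k by exact: sumr_ge0.
have s1 k : 0 < 1 + s k by rewrite ltr_pwDl.
pose w k : R := 2^-1 ^+ k / (1 + s k).
have h0 k : 0 < 2^-1 ^+ k :> R by rewrite exprn_gt0 // invr_gt0.
have w0 k : 0 < w k by rewrite divr_gt0.
exists w; split=> // P.
have wm (m : multinom n) : cvgn (series (fun k => w k * monomial_fun m (z k))).
  apply: normed_cvg.
  (* The constant absorbs the finitely many ranks [k < pickle m] at which the monomial does not yet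
     occur in [s k]. *)
  pose c := 1 + \sum_(k < pickle m) `|monomial_fun m (z k)|.
  have c1 : 1 <= c by rewrite lerDl sumr_ge0.
  apply: (@series_le_cvg _ _ (geometric c 2^-1)) => [k|k|k|].
  - exact: normr_ge0.
  - by rewrite mulr_ge0 ?(le_trans ler01 c1) // ltW.
  - rewrite /= normrM (gtr0_norm (w0 k)) /w /geometric /= [c * _]mulrC -mulrA ler_pM2l //.
    rewrite mulrC ler_pdivrMr //.
    have [kp|pk] := ltnP k (pickle m).
      apply: le_trans (_ : c <= _); last by rewrite ler_peMr ?(le_trans ler01) // lerDl.
      rewrite /c (bigD1 (Ordinal kp)) //= addrCA lerDl addr_ge0 // sumr_ge0 //.
    apply: le_trans (_ : 1 + s k <= _); last by rewrite ler_peMl // ltW.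
    have -> : `|monomial_fun m (z k)| = b (pickle m) k by rewrite /b pickleK.
    rewrite /s (bigD1 (Ordinal (pk : (pickle m < k.+1)%N))) //= addrCA lerDl.
    by rewrite addr_ge0 // sumr_ge0.
  - by apply: is_cvg_geometric_series; rewrite gtr0_norm ?invf_lt1 // ltr1n.
apply/cvg_ex; exists (\sum_(m <- msupp P)
  complex.Re (mcoeff m P) * limn (series (fun k => w k * monomial_fun m (z k)))).
have -> : series (fun k => w k * repeval P (z k)) = fun K => \sum_(m <- msupp P)
    complex.Re (mcoeff m P) * series (fun k => w k * monomial_fun m (z k)) K.
  apply/funext => K; rewrite /series /=.
  under [in RHS]eq_bigr do rewrite mulr_sumr.
  rewrite exchange_big /=; apply: eq_bigr => k _; rewrite repevalE mulr_sumr.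
  by apply: eq_bigr => m _; rewrite mulrCA.
apply: cvg_big => [|m _]; first exact: add_continuous.
by apply: cvgM; [exact: cvg_cst|exact: wm].
Qed.

(** [L] integrates against the atoms [z k] with weights [w k]. All weights being positive,
    [L (star P * P) = 0] forces [P] to vanish at every atom, hence on [V] by the choice of [z]. *)
Lemma atomic_functional (V : set 'rV[R]_n) : V !=set0 ->
  exists L, positive_definite L /\ Defs.null_set L = vanishing_set V.
Proof.
move=> /dense_sequence[z [Vz z_dense]].
have [w [w0 w_cvg]] := summable_weights z.
pose u P k := w k * repeval P (z k).
pose lam P : R := limn (series (u P)).
have lamD P Q : lam (P + Q) = lam P + lam Q.
  apply: cvg_lim => //; rewrite (_ : series _ = series (u P) \+ series (u Q)).
    by apply: cvgD; exact: w_cvg.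
  apply/funext => K; rewrite /series /= -big_split /=; apply: eq_bigr => k _.
  by rewrite /u repevalD mulrDr.
have lamZ (a : R) P : lam (a%:C *: P) = a * lam P.
  apply: cvg_lim => //; rewrite (_ : series _ = fun K => a * series (u P) K).
    by apply: cvgM; [exact: cvg_cst|exact: w_cvg].
  apply/funext => K; rewrite /series /= mulr_sumr; apply: eq_bigr => k _.
  by rewrite /u repevalZ mulrCA.
have [L LE] := complexify lamD lamZ.
have lam_sqr P : lam (star P * P) = limn (series (fun k => w k * Normc.normc (peval P (z k)) ^+ 2)).
  by rewrite /lam /u; under eq_fun do rewrite repeval_sqr.
have Lsqr P : L (star P * P) = (lam (star P * P))%:C.
  rewrite LE; congr (_ +i* _); rewrite (_ : lam _ = 0) ?oppr0 //.
  rewrite /lam (_ : series _ = fun=> 0) ?lim_cst //.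
  apply/funext => K; rewrite /series /= big1 // => k _; rewrite /u repeval_mulI.
  rewrite /peval mevalM -/(peval P _) -/(peval (star P) _) peval_star.
  by case: (peval P _) => c d /=; ring.
have partial_le P K : series (u (star P * P)) K <= lam (star P * P).
  apply: nondecreasing_cvgn_le; last exact: w_cvg.
  apply/nondecreasing_seqP => k; rewrite /series /= big_nat_recr //= lerDl.
  by rewrite /u repeval_sqr mulr_ge0 ?sqr_ge0 // ltW.
exists L; split=> [P|].
  rewrite Lsqr ler0c; apply: le_trans (partial_le P 0%N).
  by rewrite /series /= big_geq.
apply/seteqP; split=> P /=.
  rewrite /Defs.null_set /= Lsqr => /(congr1 (@complex.Re R)) /= lam0; apply: z_dense => k.
  apply: Normc.eq0_normc; apply/eqP; rewrite -sqrf_eq0 -repeval_sqr.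
  have := partial_le P k.+1; rewrite lam0 /series /= big_nat_recr //= => h.
  have : u (star P * P) k <= 0.
    apply: le_trans h; rewrite lerDr sumr_ge0 // => i _.
    by rewrite /u repeval_sqr mulr_ge0 ?sqr_ge0 // ltW.
  rewrite /u pmulr_rle0 // => le0; rewrite eq_le le0 repeval_sqr; exact: sqr_ge0.
move=> VP; rewrite /Defs.null_set /= Lsqr lam_sqr (_ : series _ = fun=> 0) ?lim_cst //.
apply/funext => K; rewrite /series /= big1 // => k _.
by rewrite VP // Normc.normc0 expr0n mulr0.
Qed.

End atomic_functional.

(** * Comparison of types A and C *)

Section type_A_type_C.
Context {R : realType} {n : nat}.
Implicit Types (P Q S : mpoly n R[i]) (L : {scalar mpoly n R[i]}) (V : set 'rV[R]_n).

(** Type C speaks only of functionals whose null set is exactly the vanishing ideal; that of [L] may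
    be larger, whence the perturbation by multiples of [L0]. *)
Lemma type_C_moment V L : type_C_set V -> positive_definite L ->
  (forall P, vanishing_set V P -> L P = 0) -> moment_functional L.
Proof.
move=> VC Lpos LV.
have sqr_in P : vanishing_set V P -> L (star P * P) = 0.
  by move=> VP; apply: LV => x Vx; rewrite /peval mevalM -/(peval P x) VP // mulr0.
(* The empty set has no atoms, but its vanishing ideal is the whole ring and is already the null set
   of [L]. *)
have [V0|/set0P V0] := eqVneq V set0.
  apply: VC => //; apply/seteqP; split=> P /=; last exact: sqr_in.
  by move=> _ x; rewrite V0.
have [L0 [L0pos L0V]] := atomic_functional V0.
have /choice[Lk LkE] : forall k : nat, exists Lk : {scalar mpoly n R[i]},
    forall P, Lk P = L P + (k.+1%:R^-1 : R)%:C * L0 P.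
  move=> k; apply: scalar_pack => c P Q.
  by rewrite !linearD !linearZ /=; ring.
have e0 k : 0 < (k.+1%:R^-1 : R)%:C by rewrite ltcR invr_gt0.
apply: (@moment_functional_closed _ _ L Lk).
  move=> k; apply: VC => [P|].
    by rewrite LkE addr_ge0 // mulr_ge0 // ltW.
  apply/seteqP; split=> P /=.
    rewrite /Defs.null_set /= LkE => /eqP; rewrite paddr_eq0 //; last by rewrite mulr_ge0 // ltW.
    move=> /andP[_]; rewrite mulf_eq0 gt_eqF //= => /eqP L0P.
    by have : Defs.null_set L0 P by []; rewrite L0V.
  move=> VP; rewrite /Defs.null_set /= LkE sqr_in // add0r.
  have L0P : Defs.null_set L0 P by rewrite L0V.
  by rewrite [X in _ * X]L0P mulr0.
move=> P.
have : complex.Re (L P) + complex.Re (L0 P) * harmonic k @[k --> \oo] -->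
    complex.Re (L P) + complex.Re (L0 P) * 0.
  by apply: cvgD; [exact: cvg_cst|apply: cvgM; [exact: cvg_cst|exact: cvg_harmonic]].
rewrite mulr0 addr0; apply: cvg_trans; apply: near_eq_cvg; apply: filterE => k.
by rewrite LkE Re_add [_%:C * _]mulrC Re_mulr.
Qed.

Lemma vanishing_set_ideal V : is_ideal (@vanishing_set R n V).
Proof.
split; first exact: (star_ideal0 (vanishing_ideal V)).
- exact: (@star_idealD R n (vanishing_ideal V)).
- exact: (@star_idealM R n (vanishing_ideal V)).
Qed.

(** This is the largest ideal inside the kernel of [L]: once it contains generators of an ideal, [L]
    vanishes on that ideal. *)
Lemma annihilator_ideal L : is_ideal [set Q | forall S, L (S * Q) = 0].
Proof.
split=> /= [S|P Q LP LQ S|P Q LQ S].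
- by rewrite mulr0 linear0.
- by rewrite mulrDr linearD LP LQ addr0.
- by rewrite mulrA.
Qed.

End type_A_type_C.

Theorem theorem7p4 (R : realType) (n : nat) (n_ge1 : (1 <= n)%N)
    (V : set 'rV[R]_n) (algV : algebraic_set V) :
  type_A_set V <-> type_C_set V.
Proof.
split=> [[P [VP PA]] L Lpos LV|VC].
  have LP : L (star P * P) = 0.
    have : Defs.null_set L P; last by [].
    by rewrite LV => x; rewrite VP.
  apply: PA => // _ [S ->]; exact: positive_definite_cauchy_schwarz.
have [P0 VP0] := algV.
have [s [sV s_gen]] := hilbert_basis (vanishing_set_ideal V).
(* Type A may be witnessed by any polynomial inducing [V]. For a sum of squares, vanishing of [P] at
   a point, or of [L] at [P], passes to each summand by positivity. *)
pose P := \sum_(Q <- s) star Q * Q.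
exists P; split.
  apply/seteqP; split=> x.
    move=> Vx; rewrite /zero_locus /= /peval /P rmorph_sum /= big_seq big1 // => Q Qs.
    by rewrite mevalM -/(peval Q x) sV // mulr0.
  rewrite /zero_locus /= => Px.
  have Q0 Q : Q \in s -> peval Q x = 0.
    move=> Qs; apply: Normc.eq0_normc; apply/eqP; rewrite -sqrf_eq0 -repeval_sqr.
    have : repeval P x == 0 by rewrite /repeval [peval P x]Px.
    rewrite /P repeval_sum psumr_eq0 => [/allP/(_ Q Qs)//|S _].
    by rewrite repeval_sqr sqr_ge0.
  (* The generators vanish at [x], so all of the vanishing ideal of [V] does, in particular the
     given [P0], whose zeros are [V]. *)
  have : vanishing_set [set x] P0.
    apply: (s_gen _ (vanishing_set_ideal [set x])).
      by move=> Q /Q0 Qx y ->.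
    by move=> y; rewrite VP0.
  by rewrite VP0; apply.
move=> L Lpos LP; apply: (type_C_moment VC) => // Q VQ.
rewrite -[Q]mul1r; apply: (s_gen _ (annihilator_ideal L)) => // T Ts S.
apply: positive_definite_cauchy_schwarz => //.
have /eqP : L P = 0 by apply: LP; exists 1; rewrite mul1r.
rewrite linear_sum psumr_eq0 => [/allP/(_ T Ts)/eqP//|W _].
exact: Lpos.
Qed.
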